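(* There is a polynomial-time $(2k^2+2)$-approximation algorithm for $k$-column-sparse packing integer programs with multiplicity constraints. That is, there is a polynomial-time algorithm which, given nonnegative rational $A$ with at most $k$ nonzero entries in each column, nonnegative rational $b,c$, and $d$ with entries in $\mathbb{Z}_{\ge0}\cup\{+\infty\}$, returns a feasible solution of $\max\{c\cdot x: Ax\le b,\ 0\le x\le d,\ x \text{ integral}\}$ whose objective value is at least $1/(2k^2+2)$ times the optimum.
   Context: A packing integer program (PIP) is an integer program $\{\max c\cdot x: Ax\le b,\ 0\le x\le d,\ x\text{ integral}\}$ with $A,b,c,d$ nonnegative and rational; the constraints $x\le d$ are multiplicity constraints, entries of $d$ may be $+\infty$, finite entries integral. It is $k$-column-sparse ($k$-CS) if each column of $A$ has at most $k$ nonzero entries. An $\alpha$-approximation algorithm for a packing problem returns a feasible solution of objective value at least $1/\alpha$ times optimal. *)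

(* Defs.v *)
From HB Require Import structures.
From mathcomp Require Import all_boot all_order all_algebra.

Set Implicit Arguments.
Unset Strict Implicit.
Unset Printing Implicit Defensive.

Import Order.TTheory GRing.Theory Num.Theory.

(* The random access machine with logarithmic cost:
   the machine of Aho, Hopcroft and Ullman (The Design and Analysis of
   Computer Algorithms, 1.2-1.3), with three-address instructions and natural
   number registers: unboundedly many registers, indirect addressing, a
   read-only input tape and a write-only output tape, where every instruction
   is charged the binary lengths of all the addresses and values that it
   handles. *)

(* l(v) = floor (log2 v) + 1 for v > 0, and l(0) = 1 *)
Definition bitlen (v : nat) : nat := (trunc_log 2 v).+1.

Definition word := seq nat.

Definition word_size (w : word) : nat := \sum_(v <- w) bitlen v.

Inductive instr : Type :=
  | Const of nat & nat          (* R[i] := v *)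
  | Add of nat & nat & nat      (* R[i] := R[j] + R[k] *)
  | Sub of nat & nat & nat      (* R[i] := max (R[j] - R[k], 0) *)
  | Mul of nat & nat & nat      (* R[i] := R[j] * R[k] *)
  | Div of nat & nat & nat      (* R[i] := floor (R[j] / R[k]), 0 if R[k] = 0 *)
  | Fetch of nat & nat          (* R[i] := R[R[j]] *)
  | Store of nat & nat          (* R[R[i]] := R[j] *)
  | Jump of nat                 (* goto l *)
  | Jzero of nat & nat          (* if R[i] = 0 goto l *)
  | Read of nat                 (* R[i] := next input, 0 if there is none *)
  | Write of nat                (* output R[i] *)
  | Halt.

Definition program := seq instr.

Record state : Type := State {
  pc : nat;
  regs : nat -> nat;
  inp : word;
  out : word
}.

Definition init_state (w : word) : state := State 0 (fun=> 0) w [::].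

Definition set_reg (s : state) (i v : nat) : state :=
  State (pc s).+1 [eta regs s with i |-> v] (inp s) (out s).

Definition goto (s : state) (l : nat) : state :=
  State l (regs s) (inp s) (out s).

(* The cost of the next instruction and the state it leads to; None when the
   machine has halted, which it also does when pc leaves the program. *)
Definition step (p : program) (s : state) : option (nat * state) :=
  let R := regs s in
  let arith i j k v :=
    Some (bitlen i + bitlen j + bitlen k + bitlen (R j) + bitlen (R k),
          set_reg s i v) in
  match nth Halt p (pc s) with
  | Const i v => Some (bitlen i + bitlen v, set_reg s i v)
  | Add i j k => arith i j k (R j + R k)
  | Sub i j k => arith i j k (R j - R k)
  | Mul i j k => arith i j k (R j * R k)
  | Div i j k => arith i j k (R j %/ R k)
  | Fetch i j =>
      Some (bitlen i + bitlen j + bitlen (R j) + bitlen (R (R j)),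
            set_reg s i (R (R j)))
  | Store i j =>
      Some (bitlen i + bitlen j + bitlen (R i) + bitlen (R j),
            set_reg s (R i) (R j))
  | Jump l => Some (bitlen l, goto s l)
  | Jzero i l =>
      Some (bitlen i + bitlen (R i) + bitlen l,
            goto s (if R i == 0 then l else (pc s).+1))
  | Read i =>
      let v := head 0 (inp s) in
      Some (bitlen i + bitlen v,
            State (pc s).+1 [eta R with i |-> v] (behead (inp s)) (out s))
  | Write i =>
      Some (bitlen i + bitlen (R i),
            State (pc s).+1 R (inp s) (rcons (out s) (R i)))
  | Halt => None
  end.

Inductive runs (p : program) : state -> nat -> state -> Prop :=
  | runs_halt s : step p s = None -> runs p s 0 s
  | runs_step s c s1 t s2 :
      step p s = Some (c, s1) -> runs p s1 t s2 -> runs p s (c + t) s2.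

Definition outputs_in (p : program) (w : word) (t : nat) (o : word) : Prop :=
  exists2 s, runs p (init_state w) t s & out s = o.

Definition outputs (p : program) (w o : word) : Prop :=
  exists t, outputs_in p w t o.

Definition polynomial_time (p : program) (D : word -> Prop) : Prop :=
  exists P : {poly nat}, forall w, D w ->
    exists t o, outputs_in p w t o /\ t <= P.[word_size w]%R.

Local Open Scope ring_scope.

(* In ubound, None stands for +oo. *)
Record pip : Type := Pip {
  nrows : nat;
  ncols : nat;
  cmat : 'M[rat]_(nrows, ncols);
  rhs : 'cV[rat]_nrows;
  obj : 'rV[rat]_ncols;
  ubound : 'I_ncols -> option nat;
  cmat_ge0 : forall i j, 0 <= cmat i j;
  rhs_ge0 : forall i, 0 <= rhs i 0;
  obj_ge0 : forall j, 0 <= obj 0 j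
}.

Arguments ubound : clear implicits.

Definition column_sparse (k : nat) (I : pip) : Prop :=
  forall j : 'I_(ncols I), (#|[set i | (cmat I i j != 0)%R]| <= k)%N.

Definition objective (I : pip) (x : 'cV[nat]_(ncols I)) : rat :=
  \sum_j obj I 0 j * (x j 0)%:R.

(* Integrality and 0 <= x are carried by the type of x. *)
Definition feasible (I : pip) (x : 'cV[nat]_(ncols I)) : Prop :=
  (forall i, \sum_j cmat I i j * (x j 0)%:R <= rhs I i 0) /\
  (forall j, if ubound I j is Some u then (x j 0%R <= u)%N else true).

Definition optimal (I : pip) (x : 'cV[nat]_(ncols I)) : Prop :=
  feasible x /\ forall y : 'cV[nat]_(ncols I),
    feasible y -> objective y <= objective x.

(* The optimum is missing exactly when the program is unbounded; then only
   feasibility is required. *)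
Definition approx_solution (alpha : rat) (I : pip) (x : 'cV[nat]_(ncols I)) :
    Prop :=
  feasible x /\
  forall y : 'cV[nat]_(ncols I),
    optimal y -> alpha^-1 * objective y <= objective x.

Definition encode_rat (q : rat) : word := [:: `|numq q|%N; `|denq q|%N].

(* +oo is written 0 and a finite bound u is written u + 1. *)
Definition encode_ubound (u : option nat) : nat :=
  if u is Some v then v.+1 else 0%N.

Definition encode_pip (I : pip) : word :=
  [:: nrows I; ncols I]
  ++ flatten [seq encode_rat (cmat I i j) | i <- enum 'I_(nrows I),
                                            j <- enum 'I_(ncols I)]
  ++ flatten [seq encode_rat (rhs I i 0) | i <- enum 'I_(nrows I)]
  ++ flatten [seq encode_rat (obj I 0 j) | j <- enum 'I_(ncols I)]
  ++ [seq encode_ubound (ubound I j) | j <- enum 'I_(ncols I)].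

Definition encode_solution (n : nat) (x : 'cV[nat]_n) : word :=
  [seq x j 0 | j <- enum 'I_n].

Definition pip_word (w : word) : Prop := exists I : pip, w = encode_pip I.

(* Main.v *)
Require Import Defs.
From mathcomp Require Import all_boot all_order all_algebra zify.

Set Implicit Arguments.
Unset Strict Implicit.
Unset Printing Implicit Defensive.

(** No linear program is solved: a local-ratio scheme suffices.

    Clear denominators and scale every row to the same right-hand side [P], so
    that the constraints read [E x <= P] with natural entries.  Let [K] be the
    largest number of nonzero entries in a column (at least 1) and [u j] the
    largest feasible multiplicity of column [j] alone.  A column is big if one
    of its entries exceeds [P / 2]; then [u j <= 1].

    The columns are processed once, the small ones first.  When its turn comes,
    a column with a positive residual weight lowers the residual weights of the
    others, in proportion to their load on its rows.  Then columns with a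
    positive residual weight are selected in reverse order:
    - a big column is accepted if each of its rows carries a load of at most
      [P / 2] so far, even if it overflows the row.  In every row only the
      column accepted last can overflow, and a big column is the last one in
      its big row; hence first-fit, in the order opposite to acceptance, splits
      the accepted columns into [K] feasible classes;
    - each small column is then added to each class as often as it fits.

    The local-ratio argument shows that an optimal solution is worth at most
    [max 4 (2 * K)] times the [K] classes together (2 times if the matrix is 0),
    hence at most [2 * k ^ 2 + 2] times the best class.

    The algorithm is written as a list of tables of natural numbers, each entry
    being an expression in earlier entries with sums, products and maxima, and
    compiled to the random access machine.  Bit lengths and running times are
    bounded by powers of [L + 2], where [L] is the size of the input. *)

(** * A small language of tables of natural numbers *)

Definition mem := seq (seq nat).

Definition get (m : mem) (a i : nat) : nat := nth 0 (nth [::] m a) i.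

Inductive binop := OAdd | OSub | OMul | ODiv | OMax.

Definition bop (o : binop) (x y : nat) : nat :=
  match o with
  | OAdd => x + y
  | OSub => x - y
  | OMul => x * y
  | ODiv => x %/ y
  | OMax => maxn x y
  end.

Inductive agg := ASum | AProd | AMax.

Definition agg_op (k : agg) : binop :=
  match k with ASum => OAdd | AProd => OMul | AMax => OMax end.

Definition agg_idx (k : agg) : nat := if k is AProd then 1 else 0.

Definition agg_eval (k : agg) (N : nat) (F : nat -> nat) : nat :=
  match k with
  | ASum => \sum_(i < N) F i
  | AProd => \prod_(i < N) F i
  | AMax => \max_(i < N) F i
  end.

Inductive bound := BConst of nat | BCell of nat & nat.

Definition bound_eval (m : mem) (b : bound) : nat :=
  match b with BConst k => k | BCell a c => get m a c end.

(* Variables are de Bruijn indices: [Big] binds one, and so does the table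
   statement that the expression belongs to. *)
Inductive expr :=
  | Cst of nat
  | Var of nat
  | Get of nat & expr
  | Bin of binop & expr & expr
  | Big of agg & bound & expr.

Fixpoint eval (m : mem) (env : seq nat) (e : expr) : nat :=
  match e with
  | Cst k => k
  | Var v => nth 0 env v
  | Get a e1 => get m a (eval m env e1)
  | Bin o e1 e2 => bop o (eval m env e1) (eval m env e2)
  | Big k b e1 => agg_eval k (bound_eval m b) (fun i => eval m (i :: env) e1)
  end.

Inductive stmt := In of bound | Tab of bound & expr.

(** The part of the table built so far is the last array of the memory in which the next entry is
    evaluated. An entry may thus refer to earlier entries of its own table, which is how recursions
    and greedy passes are expressed. *)
Fixpoint table (m : mem) (e : expr) (N : nat) : seq nat :=
  if N is x.+1 then
    rcons (table m e x) (eval (rcons m (table m e x)) [:: x] e)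
  else [::].

Definition stmt_table (m : mem) (w : word) (st : stmt) : seq nat :=
  match st with
  | In b => mkseq (nth 0 w) (bound_eval m b)
  | Tab b e => table m e (bound_eval m b)
  end.

Definition stmt_rest (m : mem) (w : word) (st : stmt) : word :=
  if st is In b then drop (bound_eval m b) w else w.

Fixpoint run (m : mem) (w : word) (ss : seq stmt) : mem :=
  if ss is st :: ss' then
    run (rcons m (stmt_table m w st)) (stmt_rest m w st) ss'
  else m.

Lemma agg_evalS k N F :
  agg_eval k N.+1 F = bop (agg_op k) (agg_eval k N F) (F N).
Proof. by case: k => /=; rewrite big_ord_recr. Qed.

Lemma agg_eval0 k F : agg_eval k 0 F = agg_idx k.
Proof. by case: k => /=; rewrite big_ord0. Qed.

Lemma size_table m e N : size (table m e N) = N.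
Proof. by elim: N => //= N IH; rewrite size_rcons IH. Qed.

Lemma take_table m e N x : x <= N -> take x (table m e N) = table m e x.
Proof.
elim: N => [|N IH]; first by rewrite leqn0 => /eqP->.
rewrite leq_eqVlt => /orP[/eqP->|lt_xN].
  by rewrite take_oversize // size_table.
by rewrite /= -cats1 takel_cat ?IH // size_table.
Qed.

Lemma nth_table m e N x : x < N ->
  nth 0 (table m e N) x = eval (rcons m (take x (table m e N))) [:: x] e.
Proof.
move=> lt_xN; rewrite take_table ?(ltnW lt_xN) //.
elim: N lt_xN => // N IH; rewrite ltnS leq_eqVlt /= nth_rcons size_table.
by case/orP=> [/eqP->|lt_xN]; [rewrite ltnn eqxx | rewrite lt_xN IH].
Qed.

Lemma take_run m w ss : take (size m) (run m w ss) = m.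
Proof.
elim: ss m w => [|st ss IH] m w /=; first by rewrite take_size.
have := IH (rcons m (stmt_table m w st)) (stmt_rest m w st).
rewrite size_rcons => /(congr1 (take (size m))).
by rewrite take_takel ?leqnSn // -cats1 take_size_cat.
Qed.

Lemma size_run m w ss : size (run m w ss) = size m + size ss.
Proof.
by elim: ss m w => [|st ss IH] m w /=; rewrite ?addn0 // IH size_rcons addSnnS.
Qed.

(** * Bit lengths *)

Lemma bitlen_leE v b : 0 < b -> (bitlen v <= b) = (v < 2 ^ b).
Proof.
move=> b_gt0; rewrite /bitlen; have [->|v_gt0] := posnP v.
  by rewrite trunc_log0 b_gt0 expn_gt0.
apply/idP/idP => [lt_b|].
  by apply: leq_trans (trunc_log_ltn v (isT : 1 < 2)) _; rewrite leq_pexp2l.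
apply: contraTT; rewrite -!leqNgt => le_b.
exact: leq_trans (leq_pexp2l (isT : 0 < 2) le_b) (trunc_logP _ v_gt0).
Qed.

Lemma bitlen_leq x y : x <= y -> bitlen x <= bitlen y.
Proof. by move=> le_xy; rewrite /bitlen ltnS leq_trunc_log. Qed.

Lemma ltn_bitlen x : x < 2 ^ bitlen x.
Proof. by rewrite -bitlen_leE. Qed.

Lemma bitlen_ltn x y : x < y -> bitlen x <= y.
Proof.
case: y => // y lt_xy; rewrite bitlen_leE //.
exact: leq_trans lt_xy (ltnW (ltn_expl _ _)).
Qed.

Lemma bitlenM x y : bitlen (x * y) <= bitlen x + bitlen y.
Proof.
rewrite bitlen_leE ?addn_gt0 // expnD.
have := ltn_bitlen x; have := ltn_bitlen y; nia.
Qed.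

Lemma bitlenD x y : bitlen (x + y) <= bitlen x + bitlen y.
Proof.
rewrite bitlen_leE ?addn_gt0 // expnD.
have := ltn_bitlen x; have := ltn_bitlen y.
have : 2 <= 2 ^ bitlen x by rewrite (leq_pexp2l (m := 2) (n1 := 1)).
have : 2 <= 2 ^ bitlen y by rewrite (leq_pexp2l (m := 2) (n1 := 1)).
nia.
Qed.

Lemma bitlen_bop o x y : bitlen (bop o x y) <= bitlen x + bitlen y.
Proof.
case: o => /=; rewrite ?bitlenD ?bitlenM //.
- by apply: leq_trans (bitlen_leq (leq_subr _ _)) (leq_addr _ _).
- by apply: leq_trans (bitlen_leq (leq_div _ _)) (leq_addr _ _).
- apply: leq_trans (bitlenD x y); apply: bitlen_leq; lia.
Qed.

Lemma bitlen_agg k N F b : (forall i, i < N -> bitlen (F i) <= b) ->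
  bitlen (agg_eval k N F) <= 1 + N * b.
Proof.
elim: N => [|N IH] leF; first by rewrite agg_eval0; case: k.
rewrite agg_evalS; apply: leq_trans (bitlen_bop _ _ _) _.
rewrite mulSn addnCA addnC leq_add ?leF //.
by apply: IH => i lt_iN; apply: leF; apply: ltnW.
Qed.

Section PowerBounds.
Variable L : nat.
Local Notation Z := L.+2.

Lemma leq_Zexp a b : a <= b -> Z ^ a <= Z ^ b.
Proof. by move=> le_ab; rewrite leq_pexp2l. Qed.

Lemma Zexp_gt0 a : 0 < Z ^ a. Proof. by rewrite expn_gt0. Qed.

Lemma leq_Zexp_const c : c <= Z ^ c.
Proof. exact: ltnW (ltn_expl _ _). Qed.

(** The base is at least 2, so one extra factor absorbs the sum of two terms. *)
Lemma leq_add_Zexp x y a b : x <= Z ^ a -> y <= Z ^ b ->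
  x + y <= Z ^ (a + b).+1.
Proof.
move=> le_x le_y; rewrite expnS expnD.
have := Zexp_gt0 a; have := Zexp_gt0 b; nia.
Qed.

Lemma leq_Mul_Zexp x y a b : x <= Z ^ a -> y <= Z ^ b -> x * y <= Z ^ (a + b).
Proof. by move=> le_x le_y; rewrite expnD leq_mul. Qed.

End PowerBounds.

(* The arrays whose contents bound the value of an expression; the subtrahend
   of a truncated subtraction, a divisor and an index do not matter. *)
Fixpoint size_reads (e : expr) : seq nat :=
  match e with
  | Cst _ | Var _ => [::]
  | Get a _ => [:: a]
  | Bin OSub e1 _ | Bin ODiv e1 _ => size_reads e1
  | Bin _ e1 e2 => size_reads e1 ++ size_reads e2
  | Big _ _ e1 => size_reads e1
  end.

Fixpoint bounds (e : expr) : seq bound :=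
  match e with
  | Cst _ | Var _ => [::]
  | Get _ e1 => bounds e1
  | Bin _ e1 e2 => bounds e1 ++ bounds e2
  | Big _ b e1 => b :: bounds e1
  end.

(** Bounds are numbers of iterations: their values must be polynomial, not just their bit
    lengths. *)
Definition bounded_by (Z d : nat) (m : mem) (bs : seq bound) : bool :=
  all (fun b => bound_eval m b <= Z ^ d) bs.

Lemma bounded_by_cat Z d m bs1 bs2 :
  bounded_by Z d m (bs1 ++ bs2) = bounded_by Z d m bs1 && bounded_by Z d m bs2.
Proof. exact: all_cat. Qed.

(** The exponent is fixed by the expression and by [dm] and [dn], before the input. An index stays
    below its bound, so it has at most [L.+2 ^ dn] bits, and an aggregation multiplies bit lengths
    by at most that power. *)
Lemma eval_bits (dm : nat -> nat) (dn : nat) (e : expr) :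
  exists d, forall L m env,
    (forall a i, a \in size_reads e -> bitlen (get m a i) <= L.+2 ^ dm a) ->
    bounded_by L.+2 dn m (bounds e) ->
    (forall v, bitlen (nth 0 env v) <= L.+2 ^ dn) ->
    bitlen (eval m env e) <= L.+2 ^ d.
Proof.
elim: e => [k|v|a e1 _|o e1 IH1 e2 IH2|k b e1 IH1] /=.
- exists k.+1 => L m env _ _ _; apply: leq_trans (leq_Zexp_const L k.+1).
  exact: bitlen_ltn.
- by exists dn => L m env _ _; apply.
- by exists (dm a) => L m env le_m _ _; apply: le_m; rewrite inE.
- have [d1 le1] := IH1; have [d2 le2] := IH2; exists (d1 + d2).+1.
  move=> L m env le_m; rewrite bounded_by_cat => /andP[b1 b2] le_env.
  have {}le1 : bitlen (eval m env e1) <= L.+2 ^ d1.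
    apply: le1 => // a i ai; apply: le_m.
    by case: o ai => //=; rewrite mem_cat => ->.
  have le1' : bitlen (eval m env e1) <= L.+2 ^ (d1 + d2).+1.
    by apply: leq_trans le1 (leq_Zexp _ _); rewrite leqW // leq_addr.
  have le2' : o <> OSub -> o <> ODiv -> bitlen (eval m env e2) <= L.+2 ^ d2.
    move=> o1 o2; apply: le2 => // a i ai; apply: le_m.
    by case: o o1 o2 => //= *; rewrite mem_cat ai orbT.
  case: o {le_m} le2' => le2' /=;
    try (by apply: leq_trans (bitlen_leq _) le1'; rewrite ?leq_subr ?leq_div).
  + by apply: leq_trans (bitlen_bop OAdd _ _) (leq_add_Zexp le1 (le2' _ _)).
  + by apply: leq_trans (bitlen_bop OMul _ _) (leq_add_Zexp le1 (le2' _ _)).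
  + by apply: leq_trans (bitlen_bop OMax _ _) (leq_add_Zexp le1 (le2' _ _)).
- have [d1 le1] := IH1; exists (0 + (dn + d1)).+1 => L m env le_m.
  rewrite /bounded_by /= => /andP[le_b bs] le_env.
  apply: leq_trans (bitlen_agg _ _) _.
    move=> i lt_i; apply: (le1 L) => // -[|v] //=.
    exact: leq_trans (bitlen_ltn lt_i) le_b.
  by apply: leq_add_Zexp => //; rewrite leq_Mul_Zexp.
Qed.

Definition polyb (f : nat -> nat) := exists d, forall L, f L <= L.+2 ^ d.

Lemma polyb_const c : polyb (fun=> c).
Proof. by exists c => L; apply: leq_Zexp_const. Qed.

Lemma polyb_exp d : polyb (fun L => L.+2 ^ d).
Proof. by exists d. Qed.

Lemma polybD f g : polyb f -> polyb g -> polyb (fun L => f L + g L).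
Proof.
by case=> d1 le1 [d2 le2]; exists (d1 + d2).+1 => L; apply: leq_add_Zexp.
Qed.

Lemma polybM f g : polyb f -> polyb g -> polyb (fun L => f L * g L).
Proof.
by case=> d1 le1 [d2 le2]; exists (d1 + d2) => L; apply: leq_Mul_Zexp.
Qed.

Ltac polyb_tac :=
  lazymatch goal with
  | |- polyb (fun L => _ + _) => apply: polybD; polyb_tac
  | |- polyb (fun L => _ * _) => apply: polybM; polyb_tac
  | |- polyb (fun L => L.+2 ^ _) => apply: polyb_exp
  | |- _ => first [assumption | apply: polyb_const]
  end.

(** * Compilation to the random access machine *)

(* Registers are split by residue modulo 32: residue 0 holds temporaries and
   residue [a + 1] holds array [a], so at most 31 arrays are available. *)
Definition tmp (d : nat) : nat := d * 32.
Definition cell (a i : nat) : nat := i * 32 + a.+1.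

Lemma eq_tmp d d' : (tmp d == tmp d') = (d == d').
Proof. by rewrite /tmp eqn_pmul2r. Qed.

Lemma cell_neq_tmp a i d : a < 31 -> (cell a i == tmp d) = false.
Proof. rewrite /cell /tmp => lt_a; apply/eqP; lia. Qed.

Lemma eq_cell a i a' i' : a < 31 -> a' < 31 ->
  (cell a i == cell a' i') = (a == a') && (i == i').
Proof. rewrite /cell => lt_a lt_a'; apply/eqP/andP; lia. Qed.

Definition code_at (p : program) (off : nat) (c : seq instr) : Prop :=
  forall k, k < size c -> nth Halt p (off + k) = nth Halt c k.

Lemma code_at_cat p off c1 c2 : code_at p off (c1 ++ c2) ->
  code_at p off c1 /\ code_at p (off + size c1) c2.
Proof.
move=> pc; split=> k lt_k; first by rewrite pc ?nth_cat ?lt_k // size_cat ltn_addr.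
by rewrite -addnA pc ?size_cat ?ltn_add2l // nth_cat ltnNge leq_addr addKn.
Qed.

Lemma code_at_cons p off i c : code_at p off (i :: c) ->
  nth Halt p off = i /\ code_at p off.+1 c.
Proof.
move=> pc; split=> [|k lt_k]; first by have := pc 0 isT; rewrite addn0.
by rewrite addSnnS pc.
Qed.

Inductive star (p : program) : state -> nat -> state -> Prop :=
  | star_refl s : star p s 0 s
  | star_step s c s1 t s2 :
      step p s = Some (c, s1) -> star p s1 t s2 -> star p s (c + t) s2.

Lemma star_trans p s t s1 t1 s2 :
  star p s t s1 -> star p s1 t1 s2 -> star p s (t + t1) s2.
Proof.
elim=> [s' //|s' c s1' t' s2' eq_step _ IH /IH star1].
by rewrite -addnA; apply: star_step eq_step star1.
Qed.

Lemma star_runs p s t s1 t1 s2 :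
  star p s t s1 -> runs p s1 t1 s2 -> runs p s (t + t1) s2.
Proof.
elim=> [s' //|s' c s1' t' s2' eq_step _ IH /IH runs1].
by rewrite -addnA; apply: runs_step eq_step runs1.
Qed.

Definition reach (p : program) (s : state) (T : nat) (s' : state) : Prop :=
  exists2 t, t <= T & star p s t s'.

Lemma reach_refl p s T : reach p s T s.
Proof. by exists 0 => //; apply: star_refl. Qed.

Lemma reach_trans p s T1 s1 T2 s2 :
  reach p s T1 s1 -> reach p s1 T2 s2 -> reach p s (T1 + T2) s2.
Proof.
by case=> t1 le1 r1 [t2 le2 r2]; exists (t1 + t2);
  [apply: leq_add | apply: star_trans r1 r2].
Qed.

Lemma reach_leq p s T T' s' : reach p s T s' -> T <= T' -> reach p s T' s'.
Proof. by case=> t le_t r le_T; exists t => //; apply: leq_trans le_T. Qed.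

Section Steps.
Variables (p : program) (s : state) (q : nat).
Local Notation R := (regs s).

(** An instruction is charged for at most five addresses and values, each of bit length at most
    [q]. *)
Lemma reach_step c s1 : step p s = Some (c, s1) -> c <= 5 * q ->
  reach p s (5 * q) s1.
Proof.
move=> eq_step le_c; exists c => //; rewrite -[c]addn0.
exact: star_step eq_step (star_refl _ _).
Qed.

Lemma reach_Const i v : nth Halt p (pc s) = Const i v ->
  bitlen i <= q -> bitlen v <= q -> reach p s (5 * q) (set_reg s i v).
Proof. by move=> eq_i *; apply: reach_step; [by rewrite /step eq_i | lia]. Qed.

Lemma reach_Add i j k : nth Halt p (pc s) = Add i j k ->
  bitlen i <= q -> bitlen j <= q -> bitlen k <= q ->
  bitlen (R j) <= q -> bitlen (R k) <= q ->
  reach p s (5 * q) (set_reg s i (R j + R k)).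
Proof. by move=> eq_i *; apply: reach_step; [by rewrite /step eq_i | lia]. Qed.

Lemma reach_Sub i j k : nth Halt p (pc s) = Defs.Sub i j k ->
  bitlen i <= q -> bitlen j <= q -> bitlen k <= q ->
  bitlen (R j) <= q -> bitlen (R k) <= q ->
  reach p s (5 * q) (set_reg s i (R j - R k)).
Proof. by move=> eq_i *; apply: reach_step; [by rewrite /step eq_i | lia]. Qed.

Lemma reach_Mul i j k : nth Halt p (pc s) = Mul i j k ->
  bitlen i <= q -> bitlen j <= q -> bitlen k <= q ->
  bitlen (R j) <= q -> bitlen (R k) <= q ->
  reach p s (5 * q) (set_reg s i (R j * R k)).
Proof. by move=> eq_i *; apply: reach_step; [by rewrite /step eq_i | lia]. Qed.

Lemma reach_Div i j k : nth Halt p (pc s) = Div i j k ->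
  bitlen i <= q -> bitlen j <= q -> bitlen k <= q ->
  bitlen (R j) <= q -> bitlen (R k) <= q ->
  reach p s (5 * q) (set_reg s i (R j %/ R k)).
Proof. by move=> eq_i *; apply: reach_step; [by rewrite /step eq_i | lia]. Qed.

Lemma reach_Fetch i j : nth Halt p (pc s) = Fetch i j ->
  bitlen i <= q -> bitlen j <= q ->
  bitlen (R j) <= q -> bitlen (R (R j)) <= q ->
  reach p s (5 * q) (set_reg s i (R (R j))).
Proof. by move=> eq_i *; apply: reach_step; [by rewrite /step eq_i | lia]. Qed.

Lemma reach_Store i j : nth Halt p (pc s) = Store i j ->
  bitlen i <= q -> bitlen j <= q -> bitlen (R i) <= q -> bitlen (R j) <= q ->
  reach p s (5 * q) (set_reg s (R i) (R j)).
Proof. by move=> eq_i *; apply: reach_step; [by rewrite /step eq_i | lia]. Qed.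

Lemma reach_Jump l : nth Halt p (pc s) = Jump l ->
  bitlen l <= q -> reach p s (5 * q) (goto s l).
Proof. by move=> eq_i *; apply: reach_step; [by rewrite /step eq_i | lia]. Qed.

Lemma reach_Jzero i l : nth Halt p (pc s) = Jzero i l ->
  bitlen i <= q -> bitlen l <= q -> bitlen (R i) <= q ->
  reach p s (5 * q) (goto s (if R i == 0 then l else (pc s).+1)).
Proof. by move=> eq_i *; apply: reach_step; [by rewrite /step eq_i | lia]. Qed.

Lemma reach_Read i : nth Halt p (pc s) = Read i ->
  bitlen i <= q -> bitlen (head 0 (inp s)) <= q ->
  reach p s (5 * q) (State (pc s).+1 [eta R with i |-> head 0 (inp s)]
                           (behead (inp s)) (out s)).
Proof. by move=> eq_i *; apply: reach_step; [by rewrite /step eq_i | lia]. Qed.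

Lemma reach_Write i : nth Halt p (pc s) = Write i ->
  bitlen i <= q -> bitlen (R i) <= q ->
  reach p s (5 * q) (State (pc s).+1 R (inp s) (rcons (out s) (R i))).
Proof. by move=> eq_i *; apply: reach_step; [by rewrite /step eq_i | lia]. Qed.

End Steps.

(** Code working at depth [d] may overwrite the temporaries from [d] on; those below hold the
    intermediate results and counters of the enclosing code. *)
Definition same_upto_tmp (d : nat) (R R' : nat -> nat) : Prop :=
  forall r, (forall d', d <= d' -> r != tmp d') -> R' r = R r.

Lemma same_tmp d R R' d' : same_upto_tmp d R R' -> d' < d ->
  R' (tmp d') = R (tmp d').
Proof.
by move=> same lt_d; apply: same => d1 le_d1; rewrite eq_tmp; apply/eqP; lia.
Qed.

Lemma same_cell d R R' a i : same_upto_tmp d R R' -> a < 31 ->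
  R' (cell a i) = R (cell a i).
Proof. by move=> same lt_a; apply: same => d1 _; rewrite cell_neq_tmp. Qed.

Lemma same_upto_tmp_trans d R1 R2 R3 : same_upto_tmp d R1 R2 ->
  same_upto_tmp d R2 R3 -> same_upto_tmp d R1 R3.
Proof. by move=> s12 s23 r r_d; rewrite s23 // s12. Qed.

Lemma same_upto_tmp_leq d d' R1 R2 : d' <= d -> same_upto_tmp d R1 R2 ->
  same_upto_tmp d' R1 R2.
Proof.
by move=> le_d s12 r r_d; apply: s12 => d1 le1; apply: r_d; apply: leq_trans le1.
Qed.

Lemma same_upto_tmp_set d d' s v : d <= d' ->
  same_upto_tmp d (regs s) (regs (set_reg s (tmp d') v)).
Proof. by move=> le_d r r_d /=; rewrite (negPf (r_d _ le_d)). Qed.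

Definition represents (R : nat -> nat) (m : mem) : Prop :=
  forall a i, a < 31 -> R (cell a i) = get m a i.

Lemma represents_same d R R' m : same_upto_tmp d R R' -> represents R m ->
  represents R' m.
Proof. by move=> same rep a i lt_a; rewrite (same_cell _ same) ?rep. Qed.

(** The maximum is computed as [x + (y - x)] with truncated subtraction. *)
Definition op_code (o : binop) (x y : nat) : seq instr :=
  match o with
  | OAdd => [:: Add (tmp x) (tmp x) (tmp y)]
  | OSub => [:: Defs.Sub (tmp x) (tmp x) (tmp y)]
  | OMul => [:: Mul (tmp x) (tmp x) (tmp y)]
  | ODiv => [:: Div (tmp x) (tmp x) (tmp y)]
  | OMax => [:: Defs.Sub (tmp y) (tmp y) (tmp x); Add (tmp x) (tmp x) (tmp y)]
  end.

Lemma op_code_correct o x y q p s off :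
  x != y -> code_at p off (op_code o x y) -> pc s = off ->
  bitlen (tmp x) <= q -> bitlen (tmp y) <= q ->
  bitlen (regs s (tmp x)) <= q -> bitlen (regs s (tmp y)) <= q ->
  exists2 s', reach p s (10 * q) s' &
    [/\ pc s' = off + size (op_code o x y), inp s' = inp s, out s' = out s,
        regs s' (tmp x) = bop o (regs s (tmp x)) (regs s (tmp y)) &
        forall r, r != tmp x -> r != tmp y -> regs s' r = regs s r].
Proof.
move=> neq_xy + pcs bx by_ bRx bRy; rewrite -pcs => {off pcs}.
have neq_xyF : (x == y) = false by apply: negPf.
have upd v : let s' := set_reg s (tmp x) v in
  [/\ pc s' = pc s + 1, inp s' = inp s, out s' = out s,
      regs s' (tmp x) = v &
      forall r, r != tmp x -> r != tmp y -> regs s' r = regs s r].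
  by split; rewrite /= ?addn1 ?eqxx // => r /negPf->.
have le_q : 5 * q <= 10 * q by rewrite leq_mul2r orbT.
case: o => /= /code_at_cons[eq1 code].
- exists (set_reg s (tmp x) (regs s (tmp x) + regs s (tmp y))); last exact: upd.
  by apply: reach_leq le_q; apply: reach_Add.
- exists (set_reg s (tmp x) (regs s (tmp x) - regs s (tmp y))); last exact: upd.
  by apply: reach_leq le_q; apply: reach_Sub.
- exists (set_reg s (tmp x) (regs s (tmp x) * regs s (tmp y))); last exact: upd.
  by apply: reach_leq le_q; apply: reach_Mul.
- exists (set_reg s (tmp x) (regs s (tmp x) %/ regs s (tmp y))); last exact: upd.
  by apply: reach_leq le_q; apply: reach_Div.
case/code_at_cons: code => eq2 _.
eexists.
  rewrite -[10]/(5 + 5) mulnDl; apply: reach_trans.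
    exact: (reach_Sub eq1).
  apply: reach_Add; first exact: eq2; rewrite //= ?eqxx ?eq_tmp ?neq_xyF //.
  exact: leq_trans (bitlen_leq (leq_subr _ _)) bRy.
split; rewrite //= ?eqxx ?eq_tmp ?neq_xyF //; try lia.
by move=> r /negPf-> /negPf->.
Qed.

Definition bound_code (d : nat) (b : bound) : seq instr :=
  match b with
  | BConst k => [:: Const (tmp d) k]
  | BCell a c => [:: Const (tmp d) (cell a c); Fetch (tmp d) (tmp d)]
  end.

Definition bound_wf (b : bound) : bool := if b is BCell a _ then a < 31 else true.

Definition bound_static (b : bound) : nat :=
  if b is BCell a c then bitlen (cell a c) else 0.

Lemma bound_code_correct d b q p s off m :
  bound_wf b -> code_at p off (bound_code d b) -> pc s = off ->
  represents (regs s) m ->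
  bitlen (tmp d) <= q -> bound_static b <= q -> bitlen (bound_eval m b) <= q ->
  exists2 s', reach p s (10 * q) s' &
    [/\ pc s' = off + size (bound_code d b), inp s' = inp s, out s' = out s,
        regs s' (tmp d) = bound_eval m b &
        same_upto_tmp d (regs s) (regs s')].
Proof.
move=> + + pcs rep bd; rewrite -pcs => {off pcs}.
case: b => [k|a c] /= lt_a /code_at_cons[eq1 code] le1 le2.
  exists (set_reg s (tmp d) k).
    apply: reach_leq (_ : 5 * q <= _); first exact: reach_Const.
    by rewrite leq_mul2r orbT.
  by split; rewrite /= ?eqxx ?addn1 //; apply: same_upto_tmp_set.
case/code_at_cons: code => eq2 _; eexists.
  rewrite -[10]/(5 + 5) mulnDl; apply: reach_trans.
    exact: (reach_Const eq1).
  apply: reach_Fetch; first exact: eq2; rewrite //= ?eqxx ?cell_neq_tmp //.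
  by rewrite rep.
split; rewrite //= ?eqxx ?cell_neq_tmp ?rep //; first by lia.
by move=> r r_d; rewrite /= (negPf (r_d d _)).
Qed.

Definition loop_start (off d : nat) (b : bound) : nat :=
  off + (size (bound_code d.+1 b)).+1.

(** The bound is evaluated once, into [tmp d.+1]; [tmp d.+2] counts, and [tmp d.+3] holds first the
    number of iterations left and later the increment. The accumulator of an aggregation is [tmp d].
    The body starts two instructions after [loop_start], behind the exit test. *)
Definition loop_code (off d : nat) (b : bound) (c : seq instr) : seq instr :=
  bound_code d.+1 b ++
  [:: Const (tmp d.+2) 0; Defs.Sub (tmp d.+3) (tmp d.+1) (tmp d.+2);
      Jzero (tmp d.+3) (loop_start off d b + (size c + 5))] ++
  c ++
  [:: Const (tmp d.+3) 1; Add (tmp d.+2) (tmp d.+2) (tmp d.+3);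
      Jump (loop_start off d b)].

Definition loop_static (off d : nat) (b : bound) (c : seq instr) : nat :=
  bitlen (tmp d.+1) + bitlen (tmp d.+2) + bitlen (tmp d.+3) + bound_static b +
  bitlen (loop_start off d b) + bitlen (loop_start off d b + (size c + 5)).

Section Loop.
Variables (off d : nat) (b : bound) (c : seq instr).
Variables (p : program) (m : mem) (q B : nat) (inv : nat -> state -> Prop).
Local Notation N := (bound_eval m b).
Local Notation l := (loop_start off d b).

Hypothesis wf_b : bound_wf b.
Hypothesis code : code_at p off (loop_code off d b c).
Hypothesis le_static : loop_static off d b c <= q.
Hypothesis le_N : bitlen N <= q.
Hypothesis inv_same : forall i s1 s2,
  same_upto_tmp d.+1 (regs s1) (regs s2) -> inp s2 = inp s1 ->
  out s2 = out s1 -> inv i s1 -> inv i s2.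
Hypothesis body : forall i s1, i < N -> pc s1 = l + 2 ->
  regs s1 (tmp d.+2) = i -> inv i s1 ->
  exists2 s2, reach p s1 B s2 &
    [/\ pc s2 = l + 2 + size c, regs s2 (tmp d.+1) = regs s1 (tmp d.+1),
        regs s2 (tmp d.+2) = i & inv i.+1 s2].

(** Induction on the number [k] of iterations left. Each runs the body and five control instructions
    of cost at most [5 * q]; the final test takes two more. *)
Lemma loop_iterate k s i : i + k = N -> pc s = l -> regs s (tmp d.+1) = N ->
  regs s (tmp d.+2) = i -> inv i s ->
  exists2 s', reach p s (k * (B + 25 * q) + 10 * q) s' &
    pc s' = off + size (loop_code off d b c) /\ inv N s'.
Proof.
have [_ /code_at_cons[_]] := code_at_cat code.
have -> : (off + size (bound_code d.+1 b)).+1 = l by rewrite /l addnS.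
move=> /code_at_cons[eq_sub] /code_at_cons[eq_jz] /code_at_cat[_].
have -> : l.+2 + size c = l + 2 + size c by lia.
case/code_at_cons=> eq_c /code_at_cons[eq_add] /code_at_cons[eq_jump _].
have le_st := le_static; rewrite /loop_static in le_st.
have end_loop : off + size (loop_code off d b c) = l + (size c + 5).
  by rewrite /loop_code /loop_start !size_cat /=; lia.
elim: k s i => [|k IH] s i eq_k pcs r1 r2 inv_i;
  have le_i : bitlen i <= q by apply: leq_trans (bitlen_leq _) le_N; lia.
  have iN : i = N by lia.
  eexists.
    rewrite mul0n add0n -[10]/(5 + 5) mulnDl; apply: reach_trans.
      by apply: reach_Sub; [rewrite pcs; apply: eq_sub|..]; rewrite ?r1 ?r2; lia.
    apply: reach_Jzero; first by rewrite /= pcs; apply: eq_jz.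
    - lia.
    - lia.
    - rewrite /= eqxx r1 r2 iN subnn.
      exact: leq_trans (bitlen_leq (leq0n _)) le_N.
  rewrite /= eqxx r1 r2 iN subnn eqxx end_loop; split=> //.
  rewrite -iN; apply: inv_same inv_i => //=.
  by apply: same_upto_tmp_set; lia.
have lt_iN : i < N by lia.
have nz : (N - i == 0) = false by lia.
have le_sub : bitlen (N - i) <= q by apply: leq_trans (bitlen_leq _) le_N; lia.
have le1 : bitlen 1 <= q by apply: leq_trans (bitlen_leq _) le_N; lia.
pose s1 := goto (set_reg s (tmp d.+3) (N - i)) l.+2.
have r_s1 : reach p s (10 * q) s1.
  rewrite -[10]/(5 + 5) mulnDl; apply: reach_trans.
    by apply: reach_Sub; [rewrite pcs; apply: eq_sub|..]; rewrite ?r1 ?r2; lia.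
  have -> : s1 = goto (set_reg s (tmp d.+3) (N - i))
     (if regs (set_reg s (tmp d.+3) (N - i)) (tmp d.+3) == 0
      then l + (size c + 5) else (pc (set_reg s (tmp d.+3) (N - i))).+1).
    by rewrite /= eqxx nz pcs.
  rewrite r1 r2; apply: reach_Jzero; first by rewrite /= pcs; apply: eq_jz.
  - lia.
  - lia.
  - by rewrite /= eqxx.
have inv_s1 : inv i s1 by apply: inv_same inv_i => //=; apply: same_upto_tmp_set; lia.
have tmp23 : (tmp d.+2 == tmp d.+3) = false by rewrite eq_tmp; lia.
have tmp13 : (tmp d.+1 == tmp d.+3) = false by rewrite eq_tmp; lia.
have tmp12 : (tmp d.+1 == tmp d.+2) = false by rewrite eq_tmp; lia.
have [| |s2 r_s2 [pc2 r21 r22 inv2]] := body lt_iN (s1 := s1) _ _ inv_s1.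
- by rewrite /=; lia.
- by rewrite /= tmp23.
rewrite /= tmp13 r1 in r21.
pose s3 := set_reg s2 (tmp d.+3) 1.
pose s4 := set_reg s3 (tmp d.+2) i.+1.
have r_s5 : reach p s2 (15 * q) (goto s4 l).
  rewrite -[15]/(5 + 5 + 5) !mulnDl; apply: (@reach_trans _ _ _ s4).
    apply: (@reach_trans _ _ _ s3).
      by apply: reach_Const; rewrite ?pc2 //; lia.
    have -> : s4 = set_reg s3 (tmp d.+2) (regs s3 (tmp d.+2) + regs s3 (tmp d.+3)).
      by rewrite /s4 /= eqxx tmp23 r22 addn1.
    apply: reach_Add; rewrite /= ?pc2 ?eqxx ?tmp23 ?r22 //; try lia.
  by apply: reach_Jump; rewrite /= ?pc2 //; lia.
have [| | | | |s' r_s' end_s'] := IH (goto s4 l) i.+1.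
- by lia.
- by [].
- by rewrite /= tmp12 tmp13.
- by rewrite /= eqxx.
- apply: inv_same inv2 => //= r r_d.
  by rewrite /= (negPf (r_d _ _)) ?(negPf (r_d _ _)) //; lia.
exists s' => //; apply: reach_leq.
  exact: reach_trans r_s1 (reach_trans r_s2 (reach_trans r_s5 r_s')).
by rewrite mulSn; lia.
Qed.

Lemma loop_correct s : pc s = off -> represents (regs s) m -> inv 0 s ->
  exists2 s', reach p s (N * (B + 25 * q) + 25 * q) s' &
    pc s' = off + size (loop_code off d b c) /\ inv N s'.
Proof.
move=> pcs rep inv0; have [code_b /code_at_cons[eq_c _]] := code_at_cat code.
have le_st := le_static; rewrite /loop_static in le_st.
have [|||s1 r1 [pc1 in1 out1 reg1 same1]] :=
  bound_code_correct (q := q) wf_b code_b pcs rep; try lia.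
pose s2 := set_reg s1 (tmp d.+2) 0.
have r2 : reach p s1 (5 * q) s2.
  apply: reach_Const; rewrite ?pc1 //; first [exact: eq_c | lia | idtac].
  by apply: leq_trans (bitlen_leq _) le_N.
have tmp12 : (tmp d.+1 == tmp d.+2) = false by rewrite eq_tmp; lia.
have [| | | | |s' r' end'] := @loop_iterate N s2 0.
- by [].
- by rewrite /= pc1 /loop_start addnS.
- by rewrite /= tmp12.
- by rewrite /= eqxx.
- apply: inv_same inv0 => //=; apply: same_upto_tmp_trans same1 _.
  by apply: same_upto_tmp_set; lia.
exists s' => //; apply: reach_leq (reach_trans r1 (reach_trans r2 r')) _; lia.
Qed.

End Loop.

(** * Compilation of expressions *)

Fixpoint expr_wf (n : nat) (e : expr) : bool :=
  match e with
  | Cst _ => true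
  | Var v => v < n
  | Get a e1 => (a < 31) && expr_wf n e1
  | Bin _ e1 e2 => expr_wf n e1 && expr_wf n e2
  | Big _ b e1 => bound_wf b && expr_wf n.+1 e1
  end.

(** The value is left in [tmp d]. The list [cenv] names the temporaries of the bound variables,
    which are the counters of the enclosing loops. A register is copied by adding it to 0, and an
    array access first computes the address given by [cell]. *)
Fixpoint expr_code (off : nat) (cenv : seq nat) (d : nat) (e : expr) :
    seq instr :=
  match e with
  | Cst k => [:: Const (tmp d) k]
  | Var v =>
      [:: Const (tmp d) 0; Add (tmp d) (tmp d) (tmp (nth 0 cenv v))]
  | Get a e1 =>
      expr_code off cenv d e1 ++
      [:: Const (tmp d.+1) 32; Mul (tmp d) (tmp d) (tmp d.+1);
          Const (tmp d.+1) a.+1; Add (tmp d) (tmp d) (tmp d.+1);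
          Fetch (tmp d) (tmp d)]
  | Bin o e1 e2 =>
      let c1 := expr_code off cenv d e1 in
      c1 ++ expr_code (off + size c1) cenv d.+1 e2 ++ op_code o d d.+1
  | Big k b e1 =>
      Const (tmp d) (agg_idx k) ::
      loop_code off.+1 d b
        (expr_code (loop_start off.+1 d b + 2) (d.+2 :: cenv) d.+3 e1 ++
         op_code (agg_op k) d d.+3)
  end.

Definition expr_spec (e : expr) (D dn off : nat) (cenv : seq nat) (d : nat)
    (f : nat -> nat) : Prop :=
  forall L p s m env,
    let c := expr_code off cenv d e in
    code_at p off c -> pc s = off -> represents (regs s) m ->
    (forall v, v < size cenv ->
       regs s (tmp (nth 0 cenv v)) = nth 0 env v) ->
    (forall a i, bitlen (get m a i) <= L.+2 ^ D) ->
    bounded_by L.+2 dn m (bounds e) ->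
    (forall v, bitlen (nth 0 env v) <= L.+2 ^ dn) ->
    exists2 s', reach p s (f L) s' &
      [/\ pc s' = off + size c, inp s' = inp s, out s' = out s,
          regs s' (tmp d) = eval m env e &
          same_upto_tmp d (regs s) (regs s')].

(** The time bound is chosen before the input, from the code and the exponents alone. By [eval_bits]
    all intermediate values have polynomial bit length, and so do the addresses computed from
    them. *)
Lemma expr_correct e D dn cenv d off :
  expr_wf (size cenv) e -> all (ltn^~ d) cenv ->
  exists2 f, polyb f & expr_spec e D dn off cenv d f.
Proof.
elim: e cenv d off => [k|v|a e1 IH1|o e1 IH1 e2 IH2|k b e1 IH1] cenv d off /=.
- move=> _ _; exists (fun=> 5 * (bitlen (tmp d) + bitlen k)); first by polyb_tac.
  move=> L p s m env /= /code_at_cons[eq1 _] pcs rep _ _ _ _.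
  exists (set_reg s (tmp d) k); first by apply: reach_Const; rewrite ?pcs //; lia.
  by split; rewrite /= ?pcs ?addn1 ?eqxx //; apply: same_upto_tmp_set.
- move=> lt_v d_cenv; pose dv := nth 0 cenv v.
  have lt_dv : dv < d by apply: (allP d_cenv); apply: mem_nth.
  exists (fun L => 10 * (bitlen (tmp d) + bitlen (tmp dv) + L.+2 ^ dn)).
    by polyb_tac.
  move=> L p s m env /= /code_at_cons[eq1 /code_at_cons[eq2 _]] pcs rep eq_env.
  move=> _ _ le_env; have := Zexp_gt0 L dn => Z_gt0.
  set q := bitlen _ + _ + _; pose s1 := set_reg s (tmp d) 0.
  have neq_d : (tmp dv == tmp d) = false by rewrite eq_tmp; lia.
  exists (set_reg s1 (tmp d) (nth 0 env v)).
    rewrite -[10]/(5 + 5) mulnDl; apply: (@reach_trans _ _ _ s1).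
      by apply: reach_Const; rewrite ?pcs // /q ?leq_addl //; lia.
    have -> : nth 0 env v = regs s1 (tmp d) + regs s1 (tmp dv).
      by rewrite /= eqxx neq_d eq_env.
    apply: reach_Add; rewrite /= ?pcs ?eqxx ?neq_d ?eq_env //; try lia.
    by apply: leq_trans (le_env v) _; rewrite leq_addl.
  split; rewrite /= ?pcs ?eqxx //; first lia.
  by move=> r r_d; rewrite /= (negPf (r_d d _)).
- case/andP=> lt_a wf1 d_cenv; have [f1 poly1 spec1] := IH1 cenv d off wf1 d_cenv.
  have [d1 le1] := eval_bits (fun=> D) dn e1.
  pose q0 := bitlen (tmp d) + bitlen (tmp d.+1) + bitlen 32 + bitlen a.+1.
  pose qf L := q0 + q0 + L.+2 ^ d1 + L.+2 ^ D.
  exists (fun L => f1 L + 25 * qf L); first by rewrite /qf; polyb_tac.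
  move=> L p s m env /= /code_at_cat[code1 code2] pcs rep eq_env le_m bd le_env.
  have [s1 r1 [pc1 in1 out1 v1 same1]] := spec1 L p s m env code1 pcs rep eq_env
    le_m bd le_env.
  have {}le1 : bitlen (eval m env e1) <= L.+2 ^ d1 by apply: le1.
  set v := eval m env e1 in v1 le1 *.
  case/code_at_cons: code2 => i1 /code_at_cons[i2] /code_at_cons[i3].
  case/code_at_cons=> i4 /code_at_cons[i5 _].
  have neq_d : (tmp d == tmp d.+1) = false by rewrite eq_tmp; lia.
  have neq_d' : (tmp d.+1 == tmp d) = false by rewrite eq_tmp; lia.
  pose s2 := set_reg s1 (tmp d.+1) 32.
  pose s3 := set_reg s2 (tmp d) (v * 32).
  pose s4 := set_reg s3 (tmp d.+1) a.+1.
  pose s5 := set_reg s4 (tmp d) (cell a v).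
  set q := qf L; have def_q : q = q0 + q0 + L.+2 ^ d1 + L.+2 ^ D by [].
  rewrite /q0 in def_q.
  have le32 : bitlen (v * 32) <= L.+2 ^ d1 + bitlen 32.
    by apply: leq_trans (bitlenM _ _) _; rewrite leq_add2r.
  have le_cell : bitlen (cell a v) <= L.+2 ^ d1 + bitlen 32 + bitlen a.+1.
    by apply: leq_trans (bitlenD _ _) _; rewrite leq_add2r.
  have rep1 : represents (regs s1) m by apply: represents_same same1 rep.
  have val5 : regs s5 (cell a v) = get m a v.
    by rewrite /= !cell_neq_tmp // rep1.
  exists (set_reg s5 (tmp d) (get m a v)).
    apply: reach_trans r1 _; rewrite -[25]/(5 + (5 + (5 + (5 + 5)))) !mulnDl.
    apply: (@reach_trans _ _ _ s2).
      by apply: reach_Const; rewrite ?pc1 //; lia.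
    apply: (@reach_trans _ _ _ s3).
      have -> : s3 = set_reg s2 (tmp d) (regs s2 (tmp d) * regs s2 (tmp d.+1)).
        by rewrite /s3 /= eqxx neq_d v1.
      by apply: reach_Mul; rewrite /= ?eqxx ?neq_d ?v1 ?pc1 //; lia.
    apply: (@reach_trans _ _ _ s4).
      by apply: reach_Const; rewrite /= ?pc1 //; lia.
    apply: (@reach_trans _ _ _ s5).
      have -> : s5 = set_reg s4 (tmp d) (regs s4 (tmp d) + regs s4 (tmp d.+1)).
        by rewrite /s5 /= !eqxx neq_d.
      by apply: reach_Add; rewrite /= ?eqxx ?neq_d ?pc1 //; lia.
    have -> : get m a v = regs s5 (regs s5 (tmp d)) by rewrite -val5 /= eqxx.
    apply: reach_Fetch; rewrite ?val5 /=; try (rewrite ?pc1 //; lia).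
      by rewrite eqxx; lia.
    rewrite eqxx -[X in bitlen X]/(regs s5 (cell a v)) val5.
    by apply: leq_trans (le_m _ _) _; lia.
  split; rewrite //= ?eqxx ?pc1 //.
    by rewrite size_cat /=; lia.
  apply: same_upto_tmp_trans same1 _ => r r_d.
  by rewrite /= (negPf (r_d d _)) ?(negPf (r_d d.+1 _)).
- case/andP=> wf1 wf2 d_cenv.
  have d_cenv' : all (ltn^~ d.+1) cenv.
    by apply: sub_all d_cenv => x /= /ltnW.
  have [f1 poly1 spec1] := IH1 cenv d off wf1 d_cenv.
  set c1 := expr_code off cenv d e1.
  have [f2 poly2 spec2] := IH2 cenv d.+1 (off + size c1) wf2 d_cenv'.
  have [d1 le1] := eval_bits (fun=> D) dn e1.
  have [d2 le2] := eval_bits (fun=> D) dn e2.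
  pose qf L := bitlen (tmp d) + bitlen (tmp d.+1) + L.+2 ^ d1 + L.+2 ^ d2.
  exists (fun L => f1 L + (f2 L + 10 * qf L)); first by rewrite /qf; polyb_tac.
  move=> L p s m env /= /code_at_cat[code1 /code_at_cat[code2 code3]] pcs rep.
  move=> eq_env le_m; rewrite bounded_by_cat => /andP[bd1 bd2] le_env.
  have [s1 r1 [pc1 in1 out1 v1 same1]] := spec1 L p s m env code1 pcs rep eq_env
    le_m bd1 le_env.
  have eq_env1 v : v < size cenv -> regs s1 (tmp (nth 0 cenv v)) = nth 0 env v.
    move=> lt_v; rewrite (same_tmp same1) ?eq_env //.
    by apply: (allP d_cenv); apply: mem_nth.
  have [s2 r2 [pc2 in2 out2 v2 same2]] := spec2 L p s1 m env code2 pc1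
    (represents_same same1 rep) eq_env1 le_m bd2 le_env.
  have v12 : regs s2 (tmp d) = eval m env e1 by rewrite (same_tmp same2).
  have {}le1 : bitlen (eval m env e1) <= L.+2 ^ d1 by apply: le1.
  have {}le2 : bitlen (eval m env e2) <= L.+2 ^ d2 by apply: le2.
  have [|||||s3 r3 [pc3 in3 out3 v3 same3]] :=
    op_code_correct (q := qf L) (o := o) (x := d) (y := d.+1) _ code3 pc2;
    rewrite ?v12 ?v2 /qf; try lia.
  exists s3; first exact: reach_trans r1 (reach_trans r2 r3).
  split; rewrite ?in3 ?in2 ?out3 ?out2 ?v3 ?v12 ?v2 //.
    by rewrite pc3 !size_cat -!addnA.
  apply: same_upto_tmp_trans same1 _.
  apply: same_upto_tmp_trans (same_upto_tmp_leq _ same2) _ => // r r_d.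
  by rewrite same3 ?r_d.
- case/andP=> wf_b wf1 d_cenv.
  have d_cenv' : all (ltn^~ d.+3) (d.+2 :: cenv).
    by rewrite /= ltnS leqnn; apply: sub_all d_cenv => x /=; lia.
  set off1 := loop_start off.+1 d b + 2.
  have [f1 poly1 spec1] := IH1 (d.+2 :: cenv) d.+3 off1 wf1 d_cenv'.
  have [d1 le1] := eval_bits (fun=> D) dn e1.
  have [d2 le2] := eval_bits (fun=> D) dn (Big k b e1).
  set c1 := expr_code off1 (d.+2 :: cenv) d.+3 e1.
  set c := c1 ++ op_code (agg_op k) d d.+3.
  pose qf L := bitlen (tmp d) + bitlen (agg_idx k) + loop_static off.+1 d b c +
    L.+2 ^ d1 + (L.+2 ^ dn * L.+2 ^ d1) + L.+2 ^ dn + 1.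
  exists (fun L => 5 * qf L + (L.+2 ^ dn * (f1 L + 10 * qf L + 25 * qf L) +
                               25 * qf L)).
    by rewrite /qf; polyb_tac.
  move=> L p s m env /= /code_at_cons[eq1 code] pcs rep eq_env le_m.
  rewrite /bounded_by /= => /andP[le_N bd] le_env.
  pose s1 := set_reg s (tmp d) (agg_idx k).
  set q := qf L.
  have def_q : q = bitlen (tmp d) + bitlen (agg_idx k) +
    loop_static off.+1 d b c +
    L.+2 ^ d1 + (L.+2 ^ dn * L.+2 ^ d1) + L.+2 ^ dn + 1 by [].
  have r1 : reach p s (5 * q) s1 by apply: reach_Const; rewrite ?pcs //; lia.
  set N := bound_eval m b in le_N *.
  pose F i := eval m (i :: env) e1.
  pose inv i s' := [/\ inp s' = inp s, out s' = out s,
    regs s' (tmp d) = agg_eval k i F & same_upto_tmp d (regs s) (regs s')].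
  have le_F i : i < N -> bitlen (F i) <= L.+2 ^ d1.
    move=> lt_i; apply: le1 => // -[|v] //=.
    by apply: leq_trans (bitlen_ltn lt_i) le_N.
  have [| | | | | | |s' r' [pc' [in' out' v' same']]] :=
    @loop_correct off.+1 d b c p m q (f1 L + 10 * q) inv wf_b code _ _ _ _ s1.
  + by lia.
  + by apply: leq_trans (bitlen_ltn (ltnSn _)) _; lia.
  + move=> i s2 s3 same23 in23 out23 [i2 o2 v2 same2].
    split; rewrite ?in23 ?out23 ?(same_tmp same23) //.
    exact: same_upto_tmp_trans same2 (same_upto_tmp_leq _ same23).
  + move=> i s2 lt_i pc2 cnt2 [i2 o2 v2 same2].
    have [code1 code2] := code_at_cat (proj1 (code_at_cat
      (proj2 (code_at_cat (proj2 (code_at_cat code)))))).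
    have eq_off : off.+1 + size (bound_code d.+1 b) + 3 = off1.
      by rewrite /off1 /loop_start; lia.
    rewrite /= eq_off in code1 code2.
    have [||||s3 r3 [pc3 i3 o3 v3 same3]] :=
      spec1 L p s2 m (i :: env) code1 pc2 (represents_same same2 rep).
    * case=> [|v] //=; rewrite ltnS => lt_v; rewrite (same_tmp same2) ?eq_env //.
      by apply: (allP d_cenv); apply: mem_nth.
    * exact: le_m.
    * exact: bd.
    * by case=> [|v] //=; apply: leq_trans (bitlen_ltn lt_i) le_N.
    have v3d : regs s3 (tmp d) = agg_eval k i F by rewrite (same_tmp same3) //; lia.
    have [|||||s4 r4 [pc4 i4 o4 v4 same4]] :=
      op_code_correct (q := q) (o := agg_op k) (x := d) (y := d.+3) _ code2 pc3;
      rewrite ?v3 ?v3d.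
    * by lia.
    * by lia.
    * by rewrite /loop_static in def_q; lia.
    * apply: leq_trans (bitlen_agg _ (b := L.+2 ^ d1) _) _.
        by move=> j lt_j; apply: le_F; lia.
      have : i * L.+2 ^ d1 <= L.+2 ^ dn * L.+2 ^ d1 by rewrite leq_mul2r; lia.
      lia.
    * by have := le_F i lt_i; rewrite /F; lia.
    exists s4; first exact: reach_trans r3 r4.
    have same34 : same_upto_tmp d (regs s3) (regs s4).
      by move=> r r_d; rewrite same4 ?r_d //; lia.
    split.
    * by rewrite pc4 /c size_cat addnA.
    * rewrite same4 ?eq_tmp; try lia.
      by rewrite (same_tmp same3) //; lia.
    * rewrite same4 ?eq_tmp; try lia.
      by rewrite (same_tmp same3) //; lia.
    * split; rewrite ?i4 ?i3 ?o4 ?o3 // ?v4 ?v3 ?v3d ?agg_evalS //.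
      apply: same_upto_tmp_trans same2 _.
      apply: same_upto_tmp_trans (same_upto_tmp_leq _ same3) _ => //; lia.
  + by rewrite /= pcs.
  + by apply: represents_same rep; apply: (@same_upto_tmp_set d).
  + split; rewrite /= ?eqxx ?agg_eval0 //.
    exact: same_upto_tmp_set.
  exists s'.
    apply: reach_leq (reach_trans r1 r') _.
    by rewrite leq_add2l leq_add2r leq_mul2r le_N orbT.
  split=> //; by rewrite pc' addSnnS.
Qed.

(** * Compilation of statements and of whole programs *)

Definition mem_le (m M : mem) : Prop := forall a i, get m a i <= get M a i.

Lemma mem_le_bounded m M Z d bs : mem_le m M -> bounded_by Z d M bs ->
  bounded_by Z d m bs.
Proof.
move=> le_m; apply: sub_all => -[k|a c] //=; exact: leq_trans (le_m a c).
Qed.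

Lemma mem_le_bits m M d : mem_le m M ->
  (forall a i, bitlen (get M a i) <= d) -> forall a i, bitlen (get m a i) <= d.
Proof. by move=> le_m le_M a i; apply: leq_trans (le_M a i); apply: bitlen_leq. Qed.

(** A run only appends arrays, and missing cells read as 0, so every intermediate memory lies below
    the final one. Size bounds therefore have to be assumed for the final memory only. *)
Lemma mem_le_take k M : mem_le (take k M) M.
Proof.
move=> a i; rewrite /get; have [lt_a|le_a] := ltnP a k; first by rewrite nth_take.
by rewrite (nth_default [::] (leq_trans _ le_a)) ?nth_nil // size_take_min geq_minl.
Qed.

Lemma get_default m a i : size m <= a -> get m a i = 0.
Proof. by move=> le_a; rewrite /get [nth [::] _ _]nth_default // nth_nil. Qed.

Lemma get_rcons m t a i :
  get (rcons m t) a i = if a == size m then nth 0 t i else get m a i.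
Proof.
rewrite /get nth_rcons; case: ltngtP => // lt_a.
by rewrite (nth_default [::] (ltnW lt_a)).
Qed.

Lemma mem_le_rcons_take m t x : mem_le (rcons m (take x t)) (rcons m t).
Proof.
move=> a i; rewrite !get_rcons; case: eqP => // _.
have [lt_x|le_x] := ltnP i x; first by rewrite nth_take.
by rewrite nth_default // (leq_trans _ le_x) // size_take_min geq_minl.
Qed.

(** The loop of a statement counts in [tmp 2] and its body leaves the new entry in [tmp 3]. *)
Definition store_code (a : nat) : seq instr :=
  [:: Const (tmp 4) 32; Mul (tmp 4) (tmp 4) (tmp 2); Const (tmp 5) a.+1;
      Add (tmp 4) (tmp 4) (tmp 5); Store (tmp 4) (tmp 3)].

Definition store_static (a : nat) : nat :=
  bitlen (tmp 2) + bitlen (tmp 3) + bitlen (tmp 4) + bitlen (tmp 5) +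
  bitlen 32 + bitlen a.+1.

Lemma store_code_correct a q p s off m t i v :
  a < 31 -> size m = a -> i = size t ->
  code_at p off (store_code a) -> pc s = off ->
  represents (regs s) (rcons m t) ->
  regs s (tmp 2) = i -> regs s (tmp 3) = v ->
  store_static a + bitlen i + bitlen v <= q ->
  exists2 s', reach p s (25 * q) s' &
    [/\ pc s' = off + 5, inp s' = inp s, out s' = out s,
        represents (regs s') (rcons m (rcons t v)) &
        forall d, d < 4 -> regs s' (tmp d) = regs s (tmp d)].
Proof.
move=> lt_a size_m size_t code pcs rep r2 r3 le_q; rewrite /store_static in le_q.
case/code_at_cons: code => i1 /code_at_cons[i2] /code_at_cons[i3].
case/code_at_cons=> i4 /code_at_cons[i5 _].
have neq d d' : d != d' -> (tmp d == tmp d') = false by rewrite eq_tmp => /negPf.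
have le_mul : bitlen (32 * i) <= bitlen 32 + bitlen i by apply: bitlenM.
have le_cell : bitlen (cell a i) <= bitlen 32 + bitlen i + bitlen a.+1.
  by rewrite /cell mulnC; apply: leq_trans (bitlenD _ _) _; rewrite leq_add2r.
pose s2 := set_reg s (tmp 4) 32.
pose s3 := set_reg s2 (tmp 4) (32 * i).
pose s4 := set_reg s3 (tmp 5) a.+1.
pose s5 := set_reg s4 (tmp 4) (cell a i).
exists (set_reg s5 (cell a i) v).
  rewrite -[25]/(5 + (5 + (5 + (5 + 5)))) !mulnDl.
  apply: (@reach_trans _ _ _ s2); first by apply: reach_Const; rewrite ?pcs //; lia.
  apply: (@reach_trans _ _ _ s3).
    have -> : s3 = set_reg s2 (tmp 4) (regs s2 (tmp 4) * regs s2 (tmp 2)).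
      by rewrite /s3 /= r2.
    by apply: reach_Mul; rewrite /= ?eqxx ?neq // ?r2 ?pcs //; lia.
  apply: (@reach_trans _ _ _ s4).
    by apply: reach_Const; rewrite /= ?pcs //; lia.
  apply: (@reach_trans _ _ _ s5).
    have -> : s5 = set_reg s4 (tmp 4) (regs s4 (tmp 4) + regs s4 (tmp 5)).
      by rewrite /s5 /= /cell mulnC.
    by apply: reach_Add; rewrite /= ?eqxx ?neq // ?eqxx ?pcs //; lia.
  have -> : set_reg s5 (cell a i) v = set_reg s5 (regs s5 (tmp 4)) (regs s5 (tmp 3)).
    by rewrite /= r3.
  by apply: reach_Store; rewrite /= ?eqxx ?neq // ?r3 ?pcs //; lia.
split=> //=; first by lia.
  move=> a' i' lt_a' /=; rewrite eq_cell // !cell_neq_tmp // rep // !get_rcons size_m.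
  have [_|//] := eqVneq a' a; rewrite nth_rcons size_t /=.
  by case: ltngtP => // lt_i; rewrite nth_default // ltnW.
move=> d lt_d; rewrite /= [_ == cell _ _]eq_sym cell_neq_tmp // !neq //; lia.
Qed.

Definition body_code (off : nat) (st : stmt) : seq instr :=
  match st with
  | In _ => [:: Read (tmp 3)]
  | Tab _ e => expr_code off [:: 2] 3 e
  end.

Definition stmt_bound (st : stmt) : bound :=
  match st with In b | Tab b _ => b end.

Definition stmt_code (off a : nat) (st : stmt) : seq instr :=
  loop_code off 0 (stmt_bound st)
    (body_code (loop_start off 0 (stmt_bound st) + 2) st ++ store_code a).

Definition stmt_bounds (st : stmt) : seq bound :=
  match st with In b => [:: b] | Tab b e => b :: bounds e end.

Definition stmt_wf (st : stmt) : bool :=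
  match st with In b => bound_wf b | Tab b e => bound_wf b && expr_wf 1 e end.

Definition rest (w : word) (i : nat) (st : stmt) : word :=
  if st is In _ then drop i w else w.

Definition entry (m : mem) (w : word) (t : seq nat) (i : nat) (st : stmt) : nat :=
  if st is Tab _ e then eval (rcons m t) [:: i] e else nth 0 w i.

Lemma size_stmt_table m w st : size (stmt_table m w st) = bound_eval m (stmt_bound st).
Proof. by case: st => [b|b e] /=; rewrite ?size_mkseq ?size_table. Qed.

Lemma nth_stmt_table m w st i : i < bound_eval m (stmt_bound st) ->
  nth 0 (stmt_table m w st) i =
  entry m w (take i (stmt_table m w st)) i st.
Proof. by case: st => [b|b e] /= lt_i; rewrite ?nth_mkseq ?nth_table. Qed.

Lemma body_correct a st D dn off : stmt_wf st ->
  exists2 f, polyb f & forall L p s m w t i,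
    let M := rcons m t in
    code_at p off (body_code off st) -> pc s = off ->
    size m = a -> represents (regs s) M -> inp s = rest w i st ->
    regs s (tmp 2) = i -> i < L.+2 ^ dn ->
    (forall a i, bitlen (get M a i) <= L.+2 ^ D) ->
    bounded_by L.+2 dn M (stmt_bounds st) ->
    bitlen (entry m w t i st) <= L.+2 ^ D ->
    exists2 s', reach p s (f L) s' &
      [/\ pc s' = off + size (body_code off st), inp s' = rest w i.+1 st,
          out s' = out s, regs s' (tmp 3) = entry m w t i st &
          same_upto_tmp 3 (regs s) (regs s')].
Proof.
case: st => [b|b e] /= wf_st.
  exists (fun L => 5 * (bitlen (tmp 3) + L.+2 ^ D)); first by polyb_tac.
  move=> L p s m w t i code pcs _ rep inps cnt _ _ _ le_v.
  case/code_at_cons: code => eq1 _.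
  have hd : head 0 (inp s) = nth 0 w i by rewrite -nth0 inps nth_drop addn0.
  eexists.
    apply: reach_Read; first by rewrite pcs; exact: eq1.
      by rewrite leq_addr.
    by rewrite hd; apply: leq_trans le_v _; rewrite leq_addl.
  split=> //=; rewrite ?pcs ?addn1 ?eqxx //; last first.
    by move=> r r_d; rewrite /= (negPf (r_d 3 _)).
  by rewrite inps -drop1 drop_drop.
have [_ wf_e] := andP wf_st.
have [f poly_f spec] := @expr_correct e D dn [:: 2] 3 off wf_e isT.
exists f => // L p s m w t i code pcs _ rep inps cnt lt_i le_M + _.
rewrite /bounded_by /= => /andP[le_b bd].
have [||s' r' [pc' in' out' v' same']] :=
  spec L p s (rcons m t) [:: i] code pcs rep _ le_M bd.
- by case=> [|//] _ /=; rewrite cnt.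
- by case=> [|[|v]] //=; rewrite ?nth_nil;
    apply: (leq_trans (bitlen_leq (_ : _ <= i))) => //; apply: bitlen_ltn.
by exists s' => //; split=> //; rewrite in' inps.
Qed.

(** Loop invariant: after [i] iterations the registers represent the memory extended by the first
    [i] entries of the new table. *)
Lemma stmt_correct a st D dn off : a < 31 -> stmt_wf st ->
  exists2 f, polyb f & forall L p s m w,
    let M := rcons m (stmt_table m w st) in
    code_at p off (stmt_code off a st) -> pc s = off ->
    size m = a -> represents (regs s) m -> inp s = w ->
    (forall a i, bitlen (get M a i) <= L.+2 ^ D) ->
    bounded_by L.+2 dn M (stmt_bounds st) ->
    exists2 s', reach p s (f L) s' &
      [/\ pc s' = off + size (stmt_code off a st), inp s' = stmt_rest m w st,
          out s' = out s & represents (regs s') M].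
Proof.
move=> lt_a wf_st; set b := stmt_bound st; pose off1 := loop_start off 0 b + 2.
set c := body_code off1 st ++ store_code a.
have [f poly_f spec] := @body_correct a st D dn off1 wf_st.
pose q1 L := store_static a + L.+2 ^ dn + L.+2 ^ D.
pose q L := loop_static off 0 b c + L.+2 ^ dn + 1.
exists (fun L => L.+2 ^ dn * ((f L + 25 * q1 L) + 25 * q L) + 25 * q L).
  by rewrite /q1 /q; polyb_tac.
move=> L p s m w M code pcs size_m rep inps le_M bd.
have wf_b : bound_wf b by rewrite /b; case: (st) wf_st => //= b' e /andP[].
have b_m : bound_eval m b <= bound_eval M b.
  case: b {c q q1 off1 spec code wf_b} => //= a' c'; rewrite get_rcons.
  by case: eqP => // ->; rewrite get_default.
have le_b : bound_eval m b <= L.+2 ^ dn.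
  apply: leq_trans b_m _.
  by move: bd; rewrite /b; case: (st) => [b'|b' e]; rewrite /bounded_by /= => /andP[].
clear b_m; set T := stmt_table m w st in M le_M bd *.
set N := bound_eval m b in le_b.
have size_T : size T = N by rewrite size_stmt_table.
pose inv i s' := [/\ represents (regs s') (rcons m (take i T)),
  inp s' = rest w i st & out s' = out s].
have [| | | | | | |s' r' [pc' [rep' in' out']]] :=
  @loop_correct off 0 b c p m (q L) (f L + 25 * q1 L) inv wf_b code _ _ _ _ s.
- by rewrite /q; lia.
- by apply: leq_trans (bitlen_ltn (ltnSn _)) _; rewrite /q -/N; lia.
- move=> i s1 s2 same12 in12 out12 [rep1 in1 out1]; split; rewrite ?in12 ?out12 //.
  exact: represents_same same12 rep1.
- move=> i s1 lt_i pc1 cnt1 [rep1 in1 out1].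
  have [code1 code2] := code_at_cat (proj1 (code_at_cat
    (proj2 (code_at_cat (proj2 (code_at_cat code)))))).
  have eq_off : off + size (bound_code 1 b) + 3 = off1.
    by rewrite /off1 /loop_start; lia.
  rewrite /= -/b eq_off -/off1 in code1 code2.
  have le_t : mem_le (rcons m (take i T)) M by apply: mem_le_rcons_take.
  have ltZ : i < L.+2 ^ dn by apply: leq_trans le_b.
  have le_v : bitlen (entry m w (take i T) i st) <= L.+2 ^ D.
    rewrite -nth_stmt_table //; have := le_M (size m) i.
    by rewrite get_rcons eqxx.
  have [s2 r2 [pc2 in2 out2 v2 same2]] := spec L p s1 m w (take i T) i code1 pc1
    size_m rep1 in1 cnt1 ltZ (mem_le_bits le_t le_M) (mem_le_bounded le_t bd) le_v.
  have cnt2 : regs s2 (tmp 2) = i by rewrite (same_tmp same2).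
  have size_t : i = size (take i T) by rewrite size_takel // size_T ltnW.
  have [|s3 r3 [pc3 in3 out3 rep3 same3]] := store_code_correct lt_a size_m size_t
    code2 pc2 (represents_same same2 rep1) cnt2 v2 (q := q1 L).
    by have := bitlen_ltn ltZ; rewrite /q1; lia.
  exists s3; first exact: reach_trans r2 r3.
  split; rewrite ?same3 //.
  + by rewrite pc3 /c size_cat addnA.
  + by rewrite (same_tmp same2).
  split; rewrite ?in3 ?in2 ?out3 ?out2 //.
  by rewrite (take_nth 0) ?size_T // nth_stmt_table.
- by [].
- by [].
- split=> //; last by rewrite inps; case: (st) => //= b'; rewrite drop0.
  rewrite take0 => a' i' lt_a'; rewrite rep // get_rcons.
  by case: eqP => // ->; rewrite nth_nil get_default.
exists s'; first by apply: reach_leq r' _; rewrite leq_add2r leq_mul2r le_b orbT.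
split=> //.
  by rewrite in' -/N /rest /stmt_rest /N /b; case: (st).
by move: rep'; rewrite -/N -size_T take_size.
Qed.

Fixpoint prog_code (off a : nat) (ss : seq stmt) : seq instr :=
  if ss is st :: ss' then
    let c := stmt_code off a st in c ++ prog_code (off + size c) a.+1 ss'
  else [::].

Definition prog_bounds (ss : seq stmt) : seq bound := flatten (map stmt_bounds ss).

Lemma prog_correct a ss D dn off : a + size ss <= 31 -> all stmt_wf ss ->
  exists2 f, polyb f & forall L p s m w,
    let M := run m w ss in
    code_at p off (prog_code off a ss) -> pc s = off ->
    size m = a -> represents (regs s) m -> inp s = w ->
    (forall a i, bitlen (get M a i) <= L.+2 ^ D) ->
    bounded_by L.+2 dn M (prog_bounds ss) ->
    exists2 s', reach p s (f L) s' &
      [/\ pc s' = off + size (prog_code off a ss),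
          out s' = out s & represents (regs s') M].
Proof.
elim: ss a off => [|st ss IH] a off /= le_a.
  move=> _; exists (fun=> 0); first exact: polyb_const.
  move=> L p s m w _ pcs _ rep _ _ _; exists s; first exact: reach_refl.
  by rewrite addn0.
case/andP=> wf_st wf_ss.
have [|f1 poly1 spec1] := @stmt_correct a st D dn off _ wf_st; first by lia.
set c := stmt_code off a st.
have [|f2 poly2 spec2] := IH a.+1 (off + size c) _ wf_ss; first by lia.
exists (fun L => f1 L + f2 L); first by polyb_tac.
move=> L p s m w /= /code_at_cat[code1 code2] pcs size_m rep inps le_M.
rewrite bounded_by_cat => /andP[bd1 bd2].
set m1 := rcons m _ in le_M bd1 bd2 *; set w1 := stmt_rest _ _ _ in le_M bd1 bd2 *.
have le_m1 : mem_le m1 (run m1 w1 ss).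
  by rewrite -{1}(take_run m1 w1 ss); apply: mem_le_take.
have [s1 r1 [pc1 in1 out1 rep1]] := spec1 L p s m w code1 pcs size_m rep inps
  (mem_le_bits le_m1 le_M) (mem_le_bounded le_m1 bd1).
have [|s2 r2 [pc2 out2 rep2]] := spec2 L p s1 m1 w1 code2 pc1 _ rep1 in1 le_M bd2.
  by rewrite size_rcons size_m.
exists s2; first exact: reach_trans r1 r2.
by split; rewrite ?out2 // pc2 size_cat addnA.
Qed.

Definition output_code (off a : nat) (b : bound) : seq instr :=
  loop_code off 0 b
    (expr_code (loop_start off 0 b + 2) [:: 2] 3 (Get a (Var 0)) ++
     [:: Write (tmp 3)]).

Definition compile (ss : seq stmt) (b : bound) : program :=
  let c := prog_code 0 0 ss in c ++ output_code (size c) (size ss).-1 b.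

Lemma output_correct a b D dn off : a < 31 -> bound_wf b ->
  exists2 f, polyb f & forall L p s m,
    code_at p off (output_code off a b) -> pc s = off ->
    represents (regs s) m -> out s = [::] ->
    (forall a i, bitlen (get m a i) <= L.+2 ^ D) ->
    bounded_by L.+2 dn m [:: b] ->
    exists2 s', reach p s (f L) s' &
      pc s' = off + size (output_code off a b) /\
      out s' = mkseq (get m a) (bound_eval m b).
Proof.
move=> lt_a wf_b; pose e := Get a (Var 0).
set off1 := loop_start off 0 b + 2.
set c := expr_code off1 [:: 2] 3 e ++ [:: Write (tmp 3)].
have [|f poly_f spec] := @expr_correct e D dn [:: 2] 3 off1 _ isT.
  by rewrite /= lt_a.
pose q L := loop_static off 0 b c + L.+2 ^ dn + L.+2 ^ D + 1.
exists (fun L => L.+2 ^ dn * ((f L + 5 * q L) + 25 * q L) + 25 * q L).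
  by rewrite /q; polyb_tac.
move=> L p s m code pcs rep outs le_m; rewrite /bounded_by /= andbT => le_b.
pose inv i s' := represents (regs s') m /\ out s' = mkseq (get m a) i.
have [| | | | | | |s' r' [pc' [rep' out']]] :=
  @loop_correct off 0 b c p m (q L) (f L + 5 * q L) inv wf_b code _ _ _ _ s.
- by rewrite /q; lia.
- by apply: leq_trans (bitlen_ltn (ltnSn _)) _; rewrite /q; lia.
- move=> i s1 s2 same12 _ out12 [rep1 out1]; split; rewrite ?out12 //.
  exact: represents_same same12 rep1.
- move=> i s1 lt_i pc1 cnt1 [rep1 out1].
  have [code1 code2] := code_at_cat (proj1 (code_at_cat
    (proj2 (code_at_cat (proj2 (code_at_cat code)))))).
  have eq_off : off + size (bound_code 1 b) + 3 = off1.
    by rewrite /off1 /loop_start; lia.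
  rewrite [size [:: _; _; _]]/= eq_off in code1 code2.
  have [||||s2 r2 [pc2 in2 out2 v2 same2]] :=
    spec L p s1 m [:: i] code1 pc1 rep1.
  + by case=> [|//] _ /=; rewrite cnt1.
  + exact: le_m.
  + by [].
  + by case=> [|[|v]] //=; rewrite ?nth_nil;
      apply: (leq_trans (bitlen_leq (_ : _ <= i))) => //;
      apply: leq_trans (bitlen_ltn lt_i) le_b.
  have {code2} [eq_w _] := code_at_cons code2.
  eexists.
    apply: reach_trans r2 _; apply: reach_Write; first by rewrite pc2; exact: eq_w.
      by rewrite /q /loop_static; lia.
    by rewrite v2 /=; apply: leq_trans (le_m _ _) _; rewrite /q; lia.
  split.
  + by rewrite /= pc2 /c size_cat /=; lia.
  + exact: (same_tmp same2).
  + by rewrite /= (same_tmp same2).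
  split; first exact: represents_same same2 rep1.
  by rewrite /= out2 out1 v2 /= /mkseq -addn1 iotaD map_cat cats1.
- by [].
- by [].
- by split=> //; rewrite outs.
exists s' => //; apply: reach_leq r' _; rewrite leq_add2r leq_mul2r le_b orbT //.
Qed.

Theorem compile_correct ss b D dn : 0 < size ss <= 31 -> all stmt_wf ss ->
  bound_wf b ->
  exists2 f, polyb f & forall L w,
    let M := run [::] w ss in
    (forall a i, bitlen (get M a i) <= L.+2 ^ D) ->
    bounded_by L.+2 dn M (b :: prog_bounds ss) ->
    exists2 t, t <= f L &
      outputs_in (compile ss b) w t
        (mkseq (get M (size ss).-1) (bound_eval M b)).
Proof.
move=> /andP[ss_gt0 le_ss] wf_ss wf_b; set c := prog_code 0 0 ss.
have [//|f1 poly1 spec1] := @prog_correct 0 ss D dn 0 _ wf_ss.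
have [|f2 poly2 spec2] := @output_correct (size ss).-1 b D dn (size c) _ wf_b.
  by lia.
exists (fun L => f1 L + f2 L); first by polyb_tac.
move=> L w M le_M; rewrite /bounded_by /= => /andP[le_b bd].
have [code1 code2] : code_at (compile ss b) 0 c /\
    code_at (compile ss b) (0 + size c) (output_code (size c) (size ss).-1 b).
  exact: code_at_cat.
rewrite add0n in code2.
have [|s1 r1 [pc1 out1 rep1]] := spec1 L _ (init_state w) [::] w code1 erefl erefl
  _ erefl le_M bd.
  by move=> a i _; rewrite get_default.
have [|s2 r2 [pc2 out2]] := spec2 L _ s1 M code2 pc1 rep1 out1 le_M.
  by rewrite /bounded_by /= le_b.
have [t le_t star_t] := reach_trans r1 r2; exists t => //.
exists s2 => //; rewrite -[t]addn0; apply: star_runs star_t _; apply: runs_halt.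
(* The program counter is at the end of the program, where the default instruction is [Halt]. *)
by rewrite /step pc2 nth_default // /compile size_cat.
Qed.

(** * The local-ratio algorithm *)

Section LocalRatio.
Variables (m n K P : nat) (E : nat -> nat -> nat) (u c : nat -> nat).

Definition support_size (j : nat) : nat := \sum_(i < m) (0 < E i j).
Definition col_max (j : nat) : nat := \max_(i < m) E i j.
Definition is_big (j : nat) : bool := P < 2 * col_max j.
(** Small columns have the times below [n], big ones the times from [n] on. Every column has its own
    time [t], and is recovered as [t %% n]. *)
Definition time_of (j : nat) : nat := is_big j * n + j.
Definition gain (j : nat) : nat := if is_big j then 2 * K else u j.
(** Up to the common scaling, a residual weight [w] of [j] lowers that of [j'] by
    [w * charge_of j j' / (P * K)]: the load of [j'] on the rows of [j], times a factor that depends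
    on whether [j] is big. *)
Definition charge_of (j j' : nat) : nat :=
  gain j * \sum_(i < m) (0 < E i j) * E i j'.

(* Residual weights, scaled by a further factor [P * K] at each step: at step
   [time_of j] the column [j] charges every other column. *)
Fixpoint residual (t j : nat) : nat :=
  if t is t'.+1 then
    P * K * residual t' j -
    (time_of (t' %% n) == t') * (residual t' (t' %% n) * charge_of (t' %% n) j)
  else c j * (0 < u j).

Lemma residualS t j : residual t.+1 j =
  P * K * residual t j -
  (time_of (t %% n) == t) * (residual t (t %% n) * charge_of (t %% n) j).
Proof. by []. Qed.

Lemma residual0 j : residual 0 j = c j * (0 < u j). Proof. by []. Qed.

Arguments residual : simpl never.

Definition flagged (j : nat) : bool := 0 < residual (time_of j) j.

Lemma time_inj j j' : j < n -> j' < n -> time_of j = time_of j' -> j = j'.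
Proof. by rewrite /time_of; do 2!case: is_big; lia. Qed.

Lemma time_lt j : j < n -> time_of j < 2 * n.
Proof. by rewrite /time_of; case: is_big; lia. Qed.

Lemma residual_le t j : residual t.+1 j <= P * K * residual t j.
Proof. by rewrite residualS leq_subr. Qed.

(** A residual weight that has dropped to 0 stays 0. *)
Lemma residual_gt0 t t' j : t <= t' -> 0 < residual t' j -> 0 < residual t j.
Proof.
move/subnKC <-; elim: (t' - t) => [|k IH]; first by rewrite addn0.
rewrite addnS => /leq_trans/(_ (residual_le _ _)).
by rewrite !muln_gt0 => /andP[_ /IH].
Qed.

Lemma flag_u_gt0 j : flagged j -> 0 < u j.
Proof.
by move/(residual_gt0 (leq0n _)); rewrite residual0 muln_gt0 lt0b => /andP[].
Qed.

Variables (x y : nat -> nat) (C : nat).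
Hypothesis s_gt0 : 0 < P * K.
Hypothesis x_flag : forall j, j < n -> 0 < x j -> flagged j.

Let s := P * K.
(** The weight function that step [j] splits off, evaluated at [z] on [j] and the columns of later
    times. The hypothesis [charged] below is the local-ratio condition for it. *)
Let later j (z : nat -> nat) :=
  s * z j + \sum_(j' < n | time_of j < time_of j') charge_of j j' * z j'.

Hypothesis charged : forall j, j < n -> flagged j ->
  later j y <= C * later j x.

Let potential t (z : nat -> nat) := \sum_(j < n | t <= time_of j) residual t j * z j.

Let potential_skip t z : (forall j, j < n -> time_of j != t) ->
  s * potential t z = potential t.+1 z.
Proof.
move=> no_t; rewrite /potential big_distrr /=; apply: eq_big => j.
  by rewrite leq_eqVlt eq_sym (negPf (no_t j _)) ?ltn_ord.
move=> _; rewrite mulnA; congr (_ * _).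
have n_gt0 : 0 < n by apply: leq_ltn_trans (ltn_ord j).
by rewrite residualS (negPf (no_t _ _)) ?ltn_pmod // mul0n subn0.
Qed.

Let potential_split j0 z : j0 < n ->
  potential (time_of j0) z =
  residual (time_of j0) j0 * z j0 +
  \sum_(j < n | time_of j0 < time_of j) residual (time_of j0) j * z j.
Proof.
move=> lt_j0; rewrite /potential (bigD1 (Ordinal lt_j0)) //=; congr (_ + _).
apply: eq_bigl => j; rewrite ltn_neqAle andbC; congr (~~ _ && _).
apply/eqP/eqP => [->//|/(time_inj lt_j0 (ltn_ord j)) eq_j].
exact/val_inj/esym.
Qed.

Let time_mod j : j < n -> time_of j %% n = j.
Proof. by move=> lt_j; rewrite /time_of modnMDl modn_small. Qed.

Let residual_time j0 j : j0 < n ->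
  residual (time_of j0).+1 j =
  s * residual (time_of j0) j - residual (time_of j0) j0 * charge_of j0 j.
Proof. by move=> lt_j0; rewrite residualS time_mod // eqxx mul1n. Qed.

(** Truncation can only increase the new residual weights, so this direction holds for every [z]. *)
Let potential_le j z : j < n ->
  s * potential (time_of j) z <=
  potential (time_of j).+1 z + residual (time_of j) j * later j z.
Proof.
move=> lt_j; rewrite potential_split // /later /potential !mulnDr !big_distrr /=.
rewrite mulnCA addnCA leq_add2l -big_split /=; apply: leq_sum => j' _.
rewrite residual_time // [s * _]mulnA [residual _ j * (charge_of _ _ * _)]mulnA.
by rewrite -mulnDl leq_mul2r; apply/orP; right; lia.
Qed.

(** A later column with [x] positive is flagged, so its residual weight is still positive after this
    step and the subtraction was not truncated. *)
Let potential_ge j : j < n ->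
  potential (time_of j).+1 x + residual (time_of j) j * later j x <=
  s * potential (time_of j) x.
Proof.
move=> lt_j; rewrite potential_split // /later /potential !mulnDr !big_distrr /=.
rewrite [s * (_ * _)]mulnCA addnCA leq_add2l -big_split /=; apply: leq_sum => j' lt_t.
have [->|x_gt0] := posnP (x j'); first by rewrite !muln0.
rewrite [s * _]mulnA [residual _ j * (charge_of _ _ * _)]mulnA -mulnDl leq_mul2r.
apply/orP; right.
have := residual_gt0 lt_t (x_flag (ltn_ord j') x_gt0); rewrite residual_time //.
lia.
Qed.

(** Downward induction on the time. At time [2 * n] no column is left. If some column has its time
    now, [charged] is multiplied by its residual weight and added to the induction hypothesis;
    otherwise the weights are only rescaled. *)
Lemma local_ratio :
  \sum_(j < n) residual 0 j * y j <= C * \sum_(j < n) residual 0 j * x j.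
Proof.
suff pot t : t <= 2 * n -> potential t y <= C * potential t x.
  by have := pot 0 isT; rewrite /potential /=.
move/subKn <-; elim: (2 * n - t) => [|k IH]; rewrite ?subn0.
  rewrite /potential big1 // => j; rewrite leqNgt time_lt //.
have [le_k|lt_k] := leqP (2 * n) k.
  have -> : 2 * n - k.+1 = 2 * n - k by lia.
  exact: IH.
set t1 := 2 * n - k.+1; have t1S : 2 * n - k = t1.+1 by rewrite /t1; lia.
rewrite t1S in IH; rewrite -(leq_pmul2l s_gt0) -/s mulnCA.
have [/existsP[j /eqP eq_t]|no_t] := boolP [exists j : 'I_n, time_of j == t1].
  rewrite -eq_t in IH *.
  apply: leq_trans (potential_le _ (ltn_ord j)) _.
  apply: leq_trans _ (leq_mul (leqnn C) (potential_ge (ltn_ord j))).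
  rewrite mulnDr; apply: leq_add IH _; rewrite [C * (_ * _)]mulnCA leq_mul2l.
  have [//|flag_j] := posnP (residual (time_of j) j).
  exact: charged.
have {}no_t j : j < n -> time_of j != t1.
  by move=> lt_j; move/existsPn: no_t => /(_ (Ordinal lt_j)).
by rewrite !potential_skip.
Qed.

End LocalRatio.

Arguments residual : simpl never.

(** * Sums over segments of indices, and first-fit *)

Lemma sum_ltnS n t (F : nat -> nat) : t < n ->
  \sum_(j < n | j < t.+1) F j = \sum_(j < n | j < t) F j + F t.
Proof.
move=> lt_t; rewrite (bigD1 (Ordinal lt_t)) //= addnC; congr (_ + _).
by apply: eq_bigl => j; rewrite ltnS [RHS]ltn_neqAle andbC.
Qed.

Lemma sum_ltn_all n (F : nat -> nat) : \sum_(j < n | j < n) F j = \sum_(j < n) F j.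
Proof. by apply: eq_bigl => j; rewrite ltn_ord. Qed.

Lemma sum_geqS n t (F : nat -> nat) : t < n ->
  \sum_(j < n | t <= j) F j = F t + \sum_(j < n | t < j) F j.
Proof.
move=> lt_t; rewrite (bigD1 (Ordinal lt_t)) //=; congr (_ + _).
by apply: eq_bigl => j; rewrite [RHS]ltn_neqAle andbC eq_sym.
Qed.

Lemma leq_sum_term n (p : pred 'I_n) (F : 'I_n -> nat) j :
  p j -> F j <= \sum_(i < n | p i) F i.
Proof. by move=> pj; rewrite (bigD1 j) //= leq_addr. Qed.

Lemma leq_sum_sub n (p q : pred 'I_n) (F G : 'I_n -> nat) :
  (forall j, p j -> 0 < F j -> q j /\ F j <= G j) ->
  \sum_(j < n | p j) F j <= \sum_(j < n | q j) G j.
Proof.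
move=> le_FG; rewrite big_mkcond [leqRHS]big_mkcond /=; apply: leq_sum => j _.
case: ifP => // pj; have [->//|F_gt0] := posnP (F j).
by have [-> ->] := le_FG j pj F_gt0.
Qed.

(** The recursion makes [T] the indicator of the least index satisfying [p]. It is applied to the
    class of an accepted column and to the choice of the best class. *)
Lemma first_fit K (p : pred nat) (T : nat -> nat) :
  (forall k, k < K -> T k = p k && (\sum_(k' < K | k' < k) T k' == 0) :> nat) ->
  (exists k : 'I_K, p k) ->
  exists k0 : 'I_K, [/\ p k0, T k0 = 1 & forall k : 'I_K, k != k0 -> T k = 0].
Proof.
move=> T_eq [k1 pk1].
have ex_p : exists k, (k < K) && p k by exists k1; rewrite ltn_ord.
case: (ex_minnP ex_p) => k /andP[lt_k pk] min_k.
have before k' : k' < k -> T k' = 0.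
  move=> lt_kk; rewrite T_eq ?(ltn_trans lt_kk) //.
  case: (boolP (p k')) => [pk'|] //=.
  by have := min_k k'; rewrite (ltn_trans lt_kk) // pk' leqNgt lt_kk => /(_ isT).
have Tk : T k = 1 by rewrite T_eq // pk big1 // => k' lt_k'; rewrite before.
exists (Ordinal lt_k); split=> // k' neq_k.
case: (ltngtP k' k) => [|lt_kk|eq_k]; first exact: before; last first.
  by case/eqP: neq_k; apply: val_inj.
rewrite T_eq // (bigD1 (Ordinal lt_k)) //= Tk.
by rewrite andbF.
Qed.

(** * Selecting columns and splitting them into feasible classes *)

Section Rounding.
Variables (m n K P : nat) (E : nat -> nat -> nat) (u c : nat -> nat).
(** [A j] tells whether the big column [j] is accepted and [Q j k] whether it is put into class [k];
    [X j k] counts the copies of the small column [j] in class [k]. *)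
Variables (A : nat -> nat) (Q X : nat -> nat -> nat).
Local Notation big := (is_big m P E).
Local Notation time := (time_of m n P E).
Local Notation flag := (flagged m n K P E u c).
Local Notation charge := (charge_of m K P E u).

Definition accepts (j : nat) : bool :=
  [&& flag j, big j & [forall i : 'I_m, (0 < E i j) ==>
    (2 * (\sum_(j' < n | j < j') A j' * E i j') <= P)]].

Definition class_fits (j k : nat) : bool :=
  [forall i : 'I_m, \sum_(j' < n | j' < j) Q j' k * E i j' + E i j <= P].

Definition remaining (j k : nat) : nat := u j - \sum_(k' < K | k' < k) X j k'.

(** The load of row [i] in class [k] when the small column [j] is offered: all big columns are
    already there, and the small ones arrive in decreasing order. *)
Definition load (i j k : nat) : nat :=
  \sum_(j' < n) Q j' k * E i j' + \sum_(j' < n | j < j') X j' k * E i j'.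

Hypothesis P_gt0 : 0 < P.
Hypothesis K_gt0 : 0 < K.
Hypothesis supportK : forall j, j < n -> support_size m E j <= K.
Hypothesis u_fits : forall i j, i < m -> j < n -> u j * E i j <= P.
Hypothesis A_eq : forall j, j < n -> A j = accepts j.
Hypothesis Q_eq : forall j k, j < n -> k < K ->
  Q j k = [&& 0 < A j, \sum_(k' < K | k' < k) Q j k' == 0 & class_fits j k].
(** This is the minimum of [remaining j k] and of the quotients over the rows of [j], expressed by a
    maximum and truncated subtraction. *)
Hypothesis X_eq : forall j k, j < n -> k < K ->
  X j k = (flag j && ~~ big j) *
    (remaining j k - \max_(i < m) (0 < E i j) *
                       (remaining j k - (P - load i j k) %/ E i j)).

Lemma bigP j : big j -> exists i : 'I_m, P < 2 * E i j.
Proof.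
move=> big_j; apply/existsP; apply: contraTT big_j => /existsPn no_i.
rewrite /is_big -leqNgt /col_max.
suff : \max_(i < m) E i j <= P %/ 2 by lia.
by apply/bigmax_leqP => i _; have := no_i i; lia.
Qed.

Lemma smallP j (i : 'I_m) : ~~ big j -> 2 * E i j <= P.
Proof.
rewrite /is_big -leqNgt; apply: leq_trans; rewrite leq_mul2l /= /col_max.
exact: (leq_bigmax_cond (F := fun i : 'I_m => E i j)).
Qed.

Lemma big_u_le1 j : j < n -> big j -> u j <= 1.
Proof.
by move=> lt_j /bigP[i lt_P]; have := u_fits (ltn_ord i) lt_j; nia.
Qed.

Lemma A_gt0P j : j < n -> 0 < A j ->
  [/\ flag j, big j & forall i : 'I_m, 0 < E i j ->
     2 * (\sum_(j' < n | j < j') A j' * E i j') <= P].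
Proof.
move=> lt_j; rewrite A_eq // lt0b => /and3P[flag_j big_j /forallP all_i].
by split=> // i /(implyP (all_i i)).
Qed.

Lemma Q_le_A j k : j < n -> k < K -> Q j k <= A j.
Proof.
by move=> lt_j lt_k; rewrite Q_eq //; case: (A j) => [|a] //=; case: (_ && _).
Qed.

Lemma Q_gt0_A j k : j < n -> k < K -> 0 < Q j k -> 0 < A j.
Proof. by move=> lt_j lt_k /leq_trans; apply; apply: Q_le_A. Qed.

Lemma Q_unique j k k' : j < n -> k < K -> k' < K ->
  0 < Q j k -> 0 < Q j k' -> k = k'.
Proof.
move=> lt_j; wlog lt_kk : k k' / k < k' => [wl|] lt_k lt_k' Qk Qk'.
  by case: (ltngtP k k') => // lt_kk; [apply: wl | apply/esym/wl].
move: Qk'; rewrite Q_eq // lt0b => /and3P[_ /eqP sum0 _].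
have := leq_sum_term (p := fun k1 : 'I_K => k1 < k') (fun k1 => Q j k1)
  (j := Ordinal lt_k) lt_kk.
by rewrite sum0 leqNgt Qk.
Qed.

Lemma class_load t k i : k < K -> i < m -> t <= n ->
  \sum_(j < n | j < t) Q j k * E i j <= P.
Proof.
move=> lt_k lt_i; elim: t => [|t IH] lt_t; first by rewrite big_pred0.
rewrite (sum_ltnS (fun j => Q j k * E i j)) //; have [->|Q_gt0] := posnP (Q t k).
  by rewrite mul0n addn0 IH // ltnW.
move: Q_gt0; rewrite Q_eq // lt0b => Q_true; rewrite Q_true mul1n.
by case/and3P: Q_true => _ _ /forallP/(_ (Ordinal lt_i)).
Qed.

(* The column accepted last in row [i]: acceptance runs through the columns
   backwards. *)
Let last_popped i := find (fun l => (0 < A l) && (0 < E i l)) (iota 0 n).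

Let last_poppedP i j : j < n -> 0 < A j -> 0 < E i j ->
  [/\ last_popped i <= j, 0 < A (last_popped i), 0 < E i (last_popped i) &
      forall l, l < last_popped i -> 0 < A l -> E i l = 0].
Proof.
move=> lt_j Aj Eij; pose p l := (0 < A l) && (0 < E i l); have has_p : has p (iota 0 n).
  by apply/hasP; exists j; rewrite ?mem_iota // /p Aj.
have lt_n : last_popped i < n by rewrite -[n](size_iota 0) -has_find.
have /andP[A_l E_l] : p (last_popped i).
  by have := nth_find 0 has_p; rewrite nth_iota.
have before l : l < last_popped i -> ~~ p l.
  move=> lt_l; have := before_find 0 lt_l; rewrite nth_iota ?(ltn_trans lt_l) //.
  by rewrite add0n -/(p l) => ->.
split=> //.
  by rewrite leqNgt; apply/negP => /before; rewrite /p Aj Eij.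
by move=> l /before pl Al; move: pl; rewrite /p Al -eqn0Ngt => /eqP.
Qed.

(** When [last_popped i] was accepted, the columns accepted before it carried at most [P / 2] in row
    [i]. If it is not in class [k], then [j] and the columns of the class in this row are among
    those, and [j] fits. *)
Let blocked j k (i : 'I_m) : j < n -> k < K -> 0 < A j ->
  P < \sum_(j' < n | j' < j) Q j' k * E i j' + E i j ->
  [/\ 0 < E i j, last_popped i < j & 0 < Q (last_popped i) k].
Proof.
move=> lt_j lt_k Aj lt_P; have [flag_j big_j _] := A_gt0P lt_j Aj.
have le_E : E i j <= P.
  by have := u_fits (ltn_ord i) lt_j; have := flag_u_gt0 flag_j; nia.
have Eij : 0 < E i j.
  by have := class_load lt_k (ltn_ord i) (ltnW lt_j); lia.
have [le_l Al El before] := last_poppedP lt_j Aj Eij.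
(* If [j] itself were the last one, the class would not use row [i] yet, and a single copy of [j]
   fits because [u j] is positive. *)
have lt_l : last_popped i < j.
  rewrite ltn_neqAle le_l andbT; apply: contraTneq lt_P => eq_l.
  rewrite -leqNgt big1 // => j' lt_j'; have [->|Qj'] := posnP (Q j' k); first by [].
  by rewrite before ?muln0 ?eq_l // (Q_gt0_A _ lt_k).
split=> //; have lt_ln := ltn_trans lt_l lt_j.
have [Q0|//] := posnP (Q (last_popped i) k); move: lt_P; rewrite ltnNge => /negP[].
have [_ _ /(_ i El) acc_l] := A_gt0P lt_ln Al.
set S := \sum_(j' < n | last_popped i < j') _ in acc_l.
suff : \sum_(j' < n | j' < j) Q j' k * E i j' + E i j <= S by lia.
rewrite /S [leqRHS](bigD1 (Ordinal lt_j)) //= addnC leq_add //; first by nia.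
apply: leq_sum_sub => j' lt_j'; rewrite muln_gt0 => /andP[Qj' Ej'].
have Aj' := Q_gt0_A (ltn_ord j') lt_k Qj'.
rewrite leq_mul2r Q_le_A ?orbT // -val_eqE /= ltn_eqF // andbT.
split=> //; rewrite ltn_neqAle; apply/andP; split.
  by apply: contraTneq Qj' => <-; rewrite Q0.
by rewrite leqNgt; apply/negP => /before/(_ Aj') E0; rewrite E0 in Ej'.
Qed.

(* Each class blocks [j] through a different row, and none of these rows is
   the one where [j] is big, in which nothing was accepted after [j]. *)
Lemma class_exists j : j < n -> 0 < A j -> exists k : 'I_K, class_fits j k.
Proof.
move=> lt_j Aj; apply/existsP; apply: contraT => /existsPn no_k.
have /fin_all_exists[f block_f] (k : 'I_K) : exists i : 'I_m,
    [/\ 0 < E i j, last_popped i < j & 0 < Q (last_popped i) k].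
  have /forallPn[i] := no_k k; rewrite -ltnNge => lt_P.
  by exists i; apply: blocked.
have [flag_j /bigP[h lt_P] _] := A_gt0P lt_j Aj.
have Ehj : 0 < E h j by lia.
have f_inj : injective f.
  move=> k k' eq_f; apply: val_inj.
  have [_ lt_l Qk] := block_f k; have [_ _ Qk'] := block_f k'.
  rewrite -eq_f in Qk'; apply: Q_unique Qk Qk' => //.
  exact: ltn_trans lt_l lt_j.
have h_f : h \notin f @: 'I_K.
  apply/imsetP => -[k _ eq_h]; have [_] := block_f k; rewrite -eq_h => lt_l _.
  have [_ Al El _] := last_poppedP lt_j Aj Ehj.
  have [_ _ /(_ h El)] := A_gt0P (ltn_trans lt_l lt_j) Al.
  have := leq_sum_term (p := fun j' : 'I_n => last_popped h < j')
    (fun j' => A j' * E h j') (j := Ordinal lt_j) lt_l.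
  by rewrite /=; nia.
have : #|h |: f @: 'I_K| <= support_size m E j.
  have -> : support_size m E j = #|[set i : 'I_m | 0 < E i j]|.
    by rewrite /support_size -sum1dep_card [RHS]big_mkcond; apply: eq_bigr => i _;
      case: (0 < _).
  apply: subset_leq_card; apply/subsetP => i.
  rewrite !inE => /predU1P[->//|/imsetP[k _ ->]].
  by have [] := block_f k.
rewrite cardsU1 h_f card_imset // card_ord => /leq_trans/(_ (supportK lt_j)).
by rewrite add1n ltnn.
Qed.

Lemma sum_Q j : j < n -> \sum_(k < K) Q j k = A j.
Proof.
move=> lt_j; have [A0|Aj] := posnP (A j).
  by rewrite A0 big1 // => k _; rewrite Q_eq // A0.
have Aj1 : A j = 1 by move: Aj; rewrite A_eq //; case: accepts.
have [k lt_k|k0 [_ Qk0 Q0]] :=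
  @first_fit K (class_fits j) (Q j) _ (class_exists lt_j Aj).
  by rewrite Q_eq // Aj /= andbC.
by rewrite (bigD1 k0) //= Qk0 Aj1 big1.
Qed.

Lemma X_le_remaining j k : j < n -> k < K -> X j k <= remaining j k.
Proof.
move=> lt_j lt_k; rewrite X_eq //; case: (_ && _); rewrite ?mul0n // mul1n.
exact: leq_subr.
Qed.

Lemma X_gt0 j k : j < n -> k < K -> 0 < X j k -> flag j /\ ~~ big j.
Proof.
by move=> lt_j lt_k; rewrite X_eq // muln_gt0 lt0b => /andP[/andP[]].
Qed.

Lemma X_fits i j k : i < m -> j < n -> k < K -> X j k * E i j <= P - load i j k.
Proof.
move=> lt_i lt_j lt_k; have [->|Eij] := posnP (E i j); first by rewrite muln0.
rewrite -leq_divRL // X_eq //; case: (_ && _); rewrite ?mul0n // mul1n.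
set r := remaining j k; set q := _ %/ E i j.
have := leq_bigmax (F := fun i : 'I_m =>
  (0 < E i j) * (r - (P - load i j k) %/ E i j)) (Ordinal lt_i).
rewrite /= Eij mul1n -/q; set M := \max_(i < m) _ => le_M.
lia.
Qed.

(** A minimum below [remaining j k] is attained at the quotient of some row, which rejects the next
    copy. *)
Lemma X_maximal j k : j < n -> k < K -> flag j -> ~~ big j ->
  X j k < remaining j k ->
  exists2 i : 'I_m, 0 < E i j & P < load i j k + (X j k).+1 * E i j.
Proof.
move=> lt_j lt_k flag_j small_j lt_X; apply/exists_inP; apply: contraT.
move/exists_inPn => no_i.
have X_def := X_eq lt_j lt_k; rewrite flag_j small_j mul1n in X_def.
set r := remaining j k in lt_X X_def; set M := \max_(i < m) _ in X_def.
suff : M <= r - (X j k).+1 by lia.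
apply/bigmax_leqP => i _; have [E0|Eij] := posnP (E i j); first by [].
rewrite mul1n leq_sub2l // leq_divRL //.
by have := no_i i Eij; lia.
Qed.

Lemma sum_X_prefix j t : j < n -> t <= K -> \sum_(k < K | k < t) X j k <= u j.
Proof.
move=> lt_j; elim: t => [|t IH] lt_t; first by rewrite big_pred0.
rewrite (sum_ltnS (fun k => X j k)) //.
have := X_le_remaining lt_j lt_t; have := IH (ltnW lt_t); rewrite /remaining; lia.
Qed.

Lemma sum_X j : j < n -> \sum_(k < K) X j k <= u j.
Proof.
move=> lt_j; have := sum_X_prefix lt_j (leqnn K).
by rewrite (sum_ltn_all K (fun k => X j k)).
Qed.

Lemma X_lt_remaining j k : j < n -> k < K -> \sum_(k < K) X j k < u j ->
  X j k < remaining j k.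
Proof.
move=> lt_j lt_k lt_u; rewrite /remaining ltn_subRL.
rewrite -(sum_ltnS (fun k => X j k)) //; apply: leq_ltn_trans lt_u.
by apply: leq_sum_sub.
Qed.

Definition solution (k j : nat) : nat := Q j k + X j k.
Definition total (j : nat) : nat := \sum_(k < K) solution k j.

(** A big column contributes only through [Q], at most once, and is flagged, so [u j] is positive; a
    small one contributes only through [X]. *)
Lemma solution_le_u k j : k < K -> j < n -> solution k j <= u j.
Proof.
move=> lt_k lt_j; rewrite /solution; have [->|Xj] := posnP (X j k).
  rewrite addn0; have [->//|Qj] := posnP (Q j k).
  have [/flag_u_gt0 u_gt0 _ _] := A_gt0P lt_j (Q_gt0_A lt_j lt_k Qj).
  by apply: leq_trans u_gt0; rewrite Q_eq //; case: (_ && _).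
have [_ small_j] := X_gt0 lt_j lt_k Xj.
have [->|/(Q_gt0_A lt_j lt_k)/(A_gt0P lt_j)[_ big_j _]] := posnP (Q j k).
  by apply: leq_trans (X_le_remaining lt_j lt_k) _; apply: leq_subr.
by rewrite big_j in small_j.
Qed.

Lemma solution_flag k j : k < K -> j < n -> 0 < solution k j -> flag j.
Proof.
move=> lt_k lt_j; rewrite /solution addn_gt0.
by case/orP => [/(Q_gt0_A lt_j lt_k)/(A_gt0P lt_j)[]|/(X_gt0 lt_j lt_k)[]].
Qed.

Lemma total_flag j : j < n -> 0 < total j -> flag j.
Proof.
move=> lt_j; apply: contraTT => no_flag; rewrite -eqn0Ngt /total big1 // => k _.
by apply/eqP; rewrite eqn0Ngt; apply: contra no_flag; apply: solution_flag.
Qed.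

Lemma total_big j : j < n -> big j -> total j = A j.
Proof.
move=> lt_j big_j; rewrite /total /solution big_split /= sum_Q // big1 ?addn0 // => k _.
by apply/eqP; rewrite eqn0Ngt; apply/negP => /(X_gt0 lt_j (ltn_ord k))[_ /negP].
Qed.

Lemma total_small j : j < n -> ~~ big j -> total j = \sum_(k < K) X j k.
Proof.
move=> lt_j small_j; rewrite /total /solution big_split /= sum_Q //.
by rewrite A_eq // /accepts (negPf small_j) andbF.
Qed.

Lemma solution_fits k i : k < K -> i < m ->
  \sum_(j < n) solution k j * E i j <= P.
Proof.
move=> lt_k lt_i.
(* Invariant after the last [t] columns have been offered; it starts from [class_load] and is kept
   by [X_fits]. *)
suff fits t : \sum_(j < n) Q j k * E i j +
    \sum_(j < n | n - t <= j) X j k * E i j <= P.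
  under eq_bigr do rewrite /solution mulnDl.
  by rewrite big_split /=; have := fits n; rewrite subnn.
elim: t => [|t IH].
  rewrite subn0 [X in _ + X]big_pred0 ?addn0 => [|j]; last by rewrite leqNgt ltn_ord.
  have := class_load lt_k lt_i (leqnn n).
  by rewrite (sum_ltn_all n (fun j => Q j k * E i j)).
have [le_t|lt_t] := leqP n t.
  have -> : n - t.+1 = n - t by lia.
  exact: IH.
have lt_n : n - t.+1 < n by lia.
rewrite (sum_geqS (fun j => X j k * E i j)) //.
have eq_t : n - t = (n - t.+1).+1 by lia.
rewrite eq_t in IH; have := X_fits lt_i lt_n lt_k; rewrite /load; lia.
Qed.

Definition later (j : nat) (z : nat -> nat) : nat :=
  P * K * z j + \sum_(j' < n | time j < time j') charge j j' * z j'.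

(** The value separating the two sides of the local-ratio condition: [weight_le] bounds it by the
    selected columns, and [later_le] bounds any feasible solution by it. *)
Definition weight (j : nat) : nat := P * K * (if big j then 2 else u j).

Let charge_ge (i : 'I_m) j j' : 0 < E i j -> gain m K P E u j * E i j' <= charge j j'.
Proof.
move=> Eij; rewrite /charge_of leq_mul2l; apply/orP; right.
have := leq_sum_term (p := xpredT) (fun i => (0 < E i j) * E i j') (j := i) isT.
by rewrite Eij mul1n.
Qed.

(** An accepted column pays for itself. A rejected one has a row where the columns accepted earlier
    carry more than [P / 2]; these are big with larger index, so they come later in time and are
    charged with the factor [2 * K]. *)
Let weight_le_big j : j < n -> flag j -> big j -> weight j <= 2 * later j total.
Proof.
move=> lt_j flag_j big_j; rewrite /weight /later big_j total_big //.
have [A0|Aj] := posnP (A j); last first.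
  by rewrite mulnDr; apply: leq_trans (leq_addr _ _); nia.
move: (A0); rewrite A_eq // /accepts flag_j big_j /= => /eqP.
rewrite eqb0 => /forallPn[i]; rewrite negb_imply -ltnNge => /andP[Eij lt_P].
set S := \sum_(j' < n | j < j') _ in lt_P.
suff le_S : 2 * K * S <= \sum_(j' < n | time j < time j') charge j j' * total j'.
  have : K * P <= K * (2 * S) by rewrite leq_mul2l ltnW ?orbT.
  by move: le_S; set T := \sum_(_ < _ | _) _; nia.
rewrite /S big_distrr /=; apply: leq_sum_sub => j' lt_j'.
rewrite !muln_gt0 => /andP[_ /andP[Aj' _]].
have [_ big_j' _] := A_gt0P (ltn_ord j') Aj'.
rewrite /time_of big_j big_j' ltn_add2l total_big //; split=> //.
have := charge_ge j' Eij; rewrite /gain big_j => le_ch.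
by rewrite [A j' * _]mulnC mulnA leq_mul2r le_ch orbT.
Qed.

(** If all [u j] copies are used, the column pays for itself. Otherwise every class has a row that
    rejects one more copy, and the inequality is proved class by class. *)
Let weight_le_small j : j < n -> flag j -> ~~ big j ->
  weight j <= 2 * later j total.
Proof.
move=> lt_j flag_j small_j; rewrite /weight /later (negPf small_j) total_small //.
have := sum_X lt_j; rewrite leq_eqVlt => /predU1P[->|lt_u].
  by rewrite mulnDr; apply: leq_trans (leq_addr _ _); nia.
pose ld i k := \sum_(j' < n | time j < time j') solution k j' * E i j'.
(* Small columns precede the big ones in time, so everything counted in [load] is later than [j]. *)
have load_le i (k : 'I_K) : load i j k <= ld i k.
  rewrite /load /ld; under [leqRHS]eq_bigr do rewrite /solution mulnDl.
  rewrite big_split leq_add //=; apply: leq_sum_sub => j' lt_j'; rewrite muln_gt0.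
    case/andP=> /(Q_gt0_A (ltn_ord j') (ltn_ord k))/(A_gt0P (ltn_ord j'))[_ big_j' _] _.
    by rewrite /time_of big_j' (negPf small_j); split=> //; lia.
  case/andP=> /(X_gt0 (ltn_ord j') (ltn_ord k))[_ small_j'] _.
  by rewrite /time_of (negPf small_j') (negPf small_j); split.
(* The charges are regrouped by class and row. *)
have -> : \sum_(j' < n | time j < time j') charge j j' * total j' =
    \sum_(k < K) u j * \sum_(i < m) (0 < E i j) * ld i k.
  rewrite -big_distrr /= exchange_big /=.
  under eq_bigr => j' _.
    rewrite /charge_of /gain (negPf small_j) -mulnA big_distrl /=.
    over.
  rewrite -big_distrr /= exchange_big /=; congr (_ * _); apply: eq_bigr => i _.
  rewrite -big_distrr /= exchange_big /= big_distrr /=; apply: eq_bigr => j' _.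
  by rewrite -mulnA -big_distrl /= [E i j' * _]mulnC.
rewrite big_distrr -big_split /= big_distrr /=.
have -> : P * K * u j = \sum_(k < K) P * u j.
  by rewrite sum_nat_const card_ord; nia.
apply: leq_sum => k _.
have [|i Eij lt_P] := X_maximal lt_j (ltn_ord k) flag_j small_j.
  exact: X_lt_remaining.
have le_ld : ld i k <= \sum_(i < m) (0 < E i j) * ld i k.
  have := leq_sum_term (p := xpredT) (fun i => (0 < E i j) * ld i k) (j := i) isT.
  by rewrite Eij mul1n.
have := load_le i k; move: (\sum_(i < m) _) le_ld => S le_ld le_load.
have uE := u_fits (ltn_ord i) lt_j; have EP := smallP i small_j.
have lt_X := X_lt_remaining lt_j (ltn_ord k) lt_u; rewrite /remaining in lt_X.
set L := load i j k in lt_P le_load.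
(* Without a copy in the class, [2 * E i j <= P] forces a load above [P / 2]. With at least one,
   [u j * E i j <= P] and [X + 1 <= 2 * X] bound the share of the rejected copy. *)
have [X0|X_gt] := posnP (X j k).
  have : P <= 2 * L by lia.
  by rewrite X0; nia.
have u2 : 2 <= u j by lia.
have : u j * P <= u j * L + (X j k).+1 * P by nia.
have : u j * L <= u j * S by rewrite leq_mul2l; lia.
have : P * X j k <= P * K * X j k by nia.
have : 2 * P <= u j * P by nia.
nia.
Qed.

Lemma weight_le j : j < n -> flag j -> weight j <= 2 * later j total.
Proof.
move=> lt_j flag_j; case: (boolP (big j)); first exact: weight_le_big.
exact: weight_le_small.
Qed.

(** * Comparison with an arbitrary feasible solution *)

Section UpperBound.
Variables (y : nat -> nat) (kappa C : nat).
Hypothesis y_le_u : forall j, j < n -> y j <= u j.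
Hypothesis y_fits : forall i, i < m -> \sum_(j < n) y j * E i j <= P.
Hypothesis support_kappa : forall j, j < n -> support_size m E j <= kappa.
Hypothesis C_small : 2 * (K + kappa) <= C * K.
Hypothesis C_big : 0 < kappa -> 2 * K <= C.

Let charge_sum j (p : pred 'I_n) :
  \sum_(j' < n | p j') charge j j' * y j' =
  gain m K P E u j * \sum_(i < m) (0 < E i j) * \sum_(j' < n | p j') y j' * E i j'.
Proof.
under eq_bigr => j' _ do rewrite /charge_of -mulnA big_distrl /=.
rewrite -big_distrr exchange_big /=; congr (_ * _); apply: eq_bigr => i _.
rewrite big_distrr; apply: eq_bigr => j' _.
by rewrite -mulnA [E i j' * _]mulnC.
Qed.

(** Each row of [j] carries at most [P] from later columns. This suffices for a small column, where
    [kappa] rows and at most [u j] copies count; a big column needs the refinement below. *)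
Lemma later_le j : j < n -> 2 * later j y <= C * weight j.
Proof.
move=> lt_j; rewrite /later charge_sum /weight /gain.
have le_P (i : 'I_m) : \sum_(j' < n | time j < time j') y j' * E i j' <= P.
  apply: leq_trans (y_fits (ltn_ord i)); exact: leq_sum_sub.
case: ifPn => [big_j|small_j].
  have [h lt_h] := bigP big_j; have Ehj : 0 < E h j by lia.
  have kappa_gt0 : 0 < kappa.
    apply: leq_trans (support_kappa lt_j); rewrite /support_size.
    have := leq_sum_term (p := xpredT) (fun i : 'I_m => nat_of_bool (0 < E i j))
      (j := h) isT.
    by rewrite Ehj.
  suff le_K : P * K * y j + 2 * K * (\sum_(i < m) (0 < E i j) *
      \sum_(j' < n | time j < time j') y j' * E i j') <= 2 * K * (P * K).
    have : 2 * K * (P * K) <= C * (P * K) by rewrite leq_mul2r C_big ?orbT.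
    by move: le_K; set T := _ + _; lia.
  have := y_le_u lt_j; have := big_u_le1 lt_j big_j => le_u le_y.
  have sup : \sum_(i < m) (0 < E i j) * P <= K * P.
    by rewrite -big_distrl leq_mul2r supportK ?orbT.
  have [y0|y_gt0] := posnP (y j).
    rewrite y0 muln0 add0n leq_mul2l; apply/orP; right.
    rewrite mulnC in sup; apply: leq_trans sup; apply: leq_sum => i _.
    by rewrite leq_mul2l le_P orbT.
  have y1 : y j = 1 by lia.
  (* The copy of [j] itself occupies its rows, more than [P / 2] of one of them; the saving,
     multiplied by [2 * K], offsets the term [P * K] of the copy. *)
  have le_PE (i : 'I_m) :
      \sum_(j' < n | time j < time j') y j' * E i j' + E i j <= P.
    apply: leq_trans (y_fits (ltn_ord i)).
    rewrite [leqRHS](bigD1 (Ordinal lt_j)) //= y1 mul1n addnC leq_add2l.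
    apply: leq_sum_sub => j' lt_t _; split=> //.
    by apply: contraTneq lt_t => ->; rewrite ltnn.
  have : \sum_(i < m) (0 < E i j) *
      (\sum_(j' < n | time j < time j') y j' * E i j') +
      \sum_(i < m) (0 < E i j) * E i j <= K * P.
    rewrite -big_split /=; apply: leq_trans sup; apply: leq_sum => i _.
    by rewrite -mulnDr leq_mul2l le_PE orbT.
  have : P < 2 * \sum_(i < m) (0 < E i j) * E i j.
    apply: leq_trans lt_h _; rewrite leq_mul2l /=.
    have := leq_sum_term (p := xpredT) (fun i : 'I_m => (0 < E i j) * E i j)
      (j := h) isT.
    by rewrite Ehj mul1n.
  rewrite y1; nia.
have le_sum : \sum_(i < m) (0 < E i j) *
    (\sum_(j' < n | time j < time j') y j' * E i j') <= kappa * P.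
  apply: leq_trans (_ : \sum_(i < m) (0 < E i j) * P <= _).
    by apply: leq_sum => i _; rewrite leq_mul2l le_P orbT.
  by rewrite -big_distrl leq_mul2r support_kappa ?orbT.
have le_y := y_le_u lt_j.
have le1 : P * K * y j <= P * K * u j by rewrite leq_mul2l le_y orbT.
have le2 := leq_mul (leqnn (u j)) le_sum.
have le3 : 2 * (K + kappa) * (P * u j) <= C * K * (P * u j).
  by rewrite leq_mul2r C_small orbT.
by move: le2; set T := u j * _; lia.
Qed.

Lemma total_approx : \sum_(j < n) c j * y j <= C * \sum_(j < n) c j * total j.
Proof.
have PK_gt0 : 0 < P * K by rewrite muln_gt0 P_gt0.
have := @local_ratio m n K P E u c total y C PK_gt0 total_flag.
rewrite -/(later _ _); set lhs := \sum_(j < n) _; set rhs := \sum_(j < n) _ => lr.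
(* The initial residual weight drops the columns with [u j = 0], where [y] vanishes too. *)
have -> : \sum_(j < n) c j * y j = lhs.
  apply: eq_bigr => j _; rewrite residual0; have := y_le_u (ltn_ord j).
  by case: (u j) => [|v] le_y; rewrite ?muln1 //; move: le_y; case: (y j) => //;
    rewrite !muln0.
apply: leq_trans (lr _) _ => [j lt_j flag_j|].
  have := later_le lt_j; have := weight_le lt_j flag_j; rewrite /later; nia.
rewrite leq_mul2l; apply/orP; right; apply: leq_sum => j _; rewrite residual0.
by rewrite leq_mul2r; apply/orP; right; case: (0 < u j); rewrite ?muln1 ?muln0.
Qed.

End UpperBound.

End Rounding.

(** * The program *)

(** Evaluation with an abstract reader in place of a memory. With [visible] as the reader, the
    equation of a table entry computes to a formula in [get M], so that most entry lemmas hold by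
    conversion. *)
Fixpoint evalf (g : nat -> nat -> nat) (env : seq nat) (e : expr) : nat :=
  match e with
  | Cst k => k
  | Var v => nth 0 env v
  | Get a e1 => g a (evalf g env e1)
  | Bin o e1 e2 => bop o (evalf g env e1) (evalf g env e2)
  | Big k b e1 =>
      agg_eval k (match b with BConst c => c | BCell a c => g a c end)
        (fun i => evalf g (i :: env) e1)
  end.

Lemma eq_agg_eval k N (F G : nat -> nat) : F =1 G -> agg_eval k N F = agg_eval k N G.
Proof. by move=> eq_FG; case: k => /=; apply: eq_bigr => i _; apply: eq_FG. Qed.

Lemma evalfE m g env e : (forall a i, get m a i = g a i) ->
  eval m env e = evalf g env e.
Proof.
move=> eq_g; elim: e env => //= [a e IH|o e1 IH1 e2 IH2|k b e IH] env.
- by rewrite IH eq_g.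
- by rewrite IH1 IH2.
- have -> : bound_eval m b = match b with BConst c => c | BCell a c => g a c end.
    by case: b => //= a c.
  exact: eq_agg_eval.
Qed.

(* What entry [x] of table [a] can see: all the earlier tables, and the earlier
   entries of its own table; everything else still holds 0. *)
Definition visible (M : mem) (a x b : nat) : nat -> nat :=
  nth (fun=> 0) (rcons (mkseq (get M) a) (fun i => (i < x) * get M a i)) b.

Fixpoint input_at (m : mem) (w : word) (ss : seq stmt) (k : nat) : word :=
  match ss, k with
  | st :: ss', k'.+1 =>
      input_at (rcons m (stmt_table m w st)) (stmt_rest m w st) ss' k'
  | _, _ => w
  end.

(** A table never changes once written, so it can be recomputed from the final memory cut off before
    it. *)
Lemma run_nth m w ss k : k < size ss ->
  let M := run m w ss in
  nth [::] M (size m + k) =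
  stmt_table (take (size m + k) M) (input_at m w ss k) (nth (In (BConst 0)) ss k).
Proof.
elim: ss m w k => // st ss IH m w [|k] /= lt_k; last first.
  by rewrite -addSnnS -(size_rcons m (stmt_table m w st)) IH.
set m1 := rcons m _; set M := run m1 _ _.
have takeM : take (size m1) M = m1 by apply: take_run.
have lt_m : size m < size m1 by rewrite size_rcons.
rewrite addn0 -(nth_take [::] lt_m) takeM nth_rcons ltnn eqxx; congr stmt_table.
by rewrite -(take_takel _ (ltnW lt_m)) takeM /m1 -cats1 take_size_cat.
Qed.

(* Wrapping the equation keeps conversion from unfolding [run]. *)
Variant run_of (w : word) (ss : seq stmt) : mem -> Prop :=
  RunOf : run_of w ss (run [::] w ss).

Lemma run_ofE w ss M : run_of w ss M -> M = run [::] w ss.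
Proof. by case. Qed.

Section Run.
Variables (w : word) (ss : seq stmt) (M : mem).
Hypothesis M_run : run_of w ss M.

Lemma get_take a b i : b < a -> get (take a M) b i = get M b i.
Proof. by move=> lt_b; rewrite /get nth_take. Qed.

Definition bound_before (a : nat) (b : bound) : bool :=
  if b is BCell a' _ then a' < a else true.

Lemma bound_take a b : bound_before a b -> bound_eval (take a M) b = bound_eval M b.
Proof. by case: b => //= a' c; apply: get_take. Qed.

Lemma nth_tab a b e : nth (In (BConst 0)) ss a = Tab b e ->
  a < size ss -> bound_before a b ->
  nth [::] M a = table (take a M) e (bound_eval M b).
Proof.
move=> eq_st lt_a bb; have := run_nth [::] w lt_a.
by rewrite -(run_ofE M_run) add0n eq_st /= bound_take.
Qed.

Lemma tab_entry a b e x : nth (In (BConst 0)) ss a = Tab b e ->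
  a < size ss -> bound_before a b -> x < bound_eval M b ->
  get M a x = evalf (visible M a x) [:: x] e.
Proof.
move=> eq_st lt_a bb lt_x; have eq_tab := nth_tab eq_st lt_a bb.
rewrite {1}/get eq_tab nth_table // -eq_tab; apply: evalfE => b' i.
have size_a : size (take a M) = a.
  by rewrite size_takel // (run_ofE M_run) size_run ltnW.
rewrite get_rcons size_a /visible nth_rcons size_mkseq; case: ltngtP => lt_b.
- by rewrite nth_mkseq // get_take.
- by rewrite get_default // size_a ltnW.
rewrite /get eq_tab; have [lt_i|le_i] := ltnP i x.
  by rewrite nth_take // mul1n.
by rewrite nth_default // size_takel // size_table ltnW.
Qed.

(** The form needed for size bounds, where it matters only that the memory of evaluation lies below
    the final one. *)
Lemma tab_eval a b e x : nth (In (BConst 0)) ss a = Tab b e ->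
  a < size ss -> bound_before a b -> x < bound_eval M b ->
  exists2 m, mem_le m M & get M a x = eval m [:: x] e.
Proof.
move=> eq_st lt_a bb lt_x; have eq_tab := nth_tab eq_st lt_a bb.
exists (rcons (take a M) (take x (nth [::] M a))).
  have lt_aM : a < size M by rewrite (run_ofE M_run) size_run.
  move=> b' i; apply: leq_trans (mem_le_rcons_take _ _ _ _ _) _.
  by rewrite -take_nth //; apply: mem_le_take.
by rewrite {1}/get eq_tab nth_table.
Qed.

Lemma tab_default a b e x : nth (In (BConst 0)) ss a = Tab b e ->
  a < size ss -> bound_before a b -> bound_eval M b <= x -> get M a x = 0.
Proof.
move=> eq_st lt_a bb le_x; rewrite /get (nth_tab eq_st lt_a bb).
by rewrite nth_default // size_table.
Qed.

Lemma in_entry a b x : nth (In (BConst 0)) ss a = In b ->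
  a < size ss -> bound_before a b ->
  get M a x = if x < bound_eval M b then nth 0 (input_at [::] w ss a) x else 0.
Proof.
move=> eq_st lt_a bb; have := run_nth [::] w lt_a.
rewrite -(run_ofE M_run) add0n eq_st /= bound_take // /get => ->.
by case: ltnP => [lt_x|le_x]; [rewrite nth_mkseq | rewrite nth_default ?size_mkseq].
Qed.

End Run.

(* The tables of the algorithm *)
Declare Scope expr_scope.
Delimit Scope expr_scope with E.
Bind Scope expr_scope with expr.
Notation "x + y" := (Bin OAdd x y) : expr_scope.
Notation "x - y" := (Bin OSub x y) : expr_scope.
Notation "x * y" := (Bin OMul x y) : expr_scope.
Notation "x / y" := (Bin ODiv x y) : expr_scope.
Notation "a .[ e ]" := (Get a e) : expr_scope.
Notation "'ESum' ( b ) e" := (Big ASum b e) (at level 36, e at level 36) : expr_scope.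
Notation "'EProd' ( b ) e" := (Big AProd b e) (at level 36, e at level 36) : expr_scope.
Notation "'EMax' ( b ) e" := (Big AMax b e) (at level 36, e at level 36) : expr_scope.

Section Program.
Local Open Scope expr_scope.
Local Coercion Cst : nat >-> expr.
Local Notation "` v" := (Var v) (at level 0, format "` v") : expr_scope.

Definition epos (e : expr) : expr := 1 - (1 - e).
Definition ezero (e : expr) : expr := 1 - e.
Definition egt (e1 e2 : expr) : expr := epos (e1 - e2).
Definition eeq (e1 e2 : expr) : expr := 1 - ((e1 - e2) + (e2 - e1)).
Definition emin (e1 e2 : expr) : expr := e1 - (e1 - e2).
Definition emod (e1 e2 : expr) : expr := e1 - e1 / e2 * e2.

(* Matrices are stored row by row.  [aIN] is the input after its first two
   numbers [aHD], [aVAL] its rationals times their common denominator [aD], and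
   [aEM] the column maxima of [aE].  The selection runs backwards through the
   columns, so [aA] and [aX] list them in reverse order.  The sizes of the
   tables come from [aHD], [aK] and the one-entry tables [aMN], [aNP], [aLEN],
   [aNN], [aN2], [aNK]; [aT] marks the best class. *)
Definition aHD := 0.    Definition aMN := 1.    Definition aNP := 2.
Definition aLEN := 3.   Definition aIN := 4.    Definition aD := 5.
Definition aVAL := 6.   Definition aP := 7.     Definition aE := 8.
Definition aEM := 9.    Definition aU := 10.    Definition aK := 11.
Definition aBG := 12.   Definition aNN := 13.   Definition aW := 14.
Definition aN2 := 15.   Definition aR := 16.    Definition aF := 17.
Definition aA := 18.    Definition aNK := 19.   Definition aQ := 20.
Definition aX := 21.    Definition aV := 22.    Definition aBV := 23.
Definition aT := 24.    Definition aOUT := 25.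

Definition bM := BCell aHD 0.
Definition bN := BCell aHD 1.
Definition bK := BCell aK 0.
Definition cell0 (a : nat) : bound := BCell a 0.

Definition eM : expr := aHD.[0].
Definition eN : expr := aHD.[1].
Definition eK : expr := aK.[0].
Definition eP : expr := aP.[0].
Definition eE (i j : expr) : expr := aE.[i * eN + j].
Definition eC (j : expr) : expr := aVAL.[aMN.[0] + eM + j].
Definition erev (j : expr) : expr := eN - 1 - j.
Definition etime (j : expr) : expr := aBG.[j] * eN + j.
Definition eQX (j k : expr) : expr := aQ.[j * eK + k] + aX.[erev j * eK + k].

(** The minimum of the upper bound and [P] divided by the column maximum, an absent constraint being
    left out. A column with neither entries nor bound gets 0, since division by 0 gives 0. *)
Definition eU : expr :=
  let ub := aIN.[2 * aNP.[0] + `0] in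
  let em := aEM.[`0] in
  ezero ub * (eP / em) +
  epos ub * (ezero em * (ub - 1) + epos em * emin (ub - 1) (eP / em)).

Definition eW : expr :=
  let j := `0 / eN in
  (aBG.[j] * (2 * eK) + ezero aBG.[j] * aU.[j]) *
  ESum (bM) (let j := `1 / eN in epos (eE `0 j) * eE `0 (emod `1 eN)).

(** Entry [t * n + j] is the residual weight of [j] at time [t], so the previous row lies [n]
    entries back. Only the column [q] can have the time [t']. *)
Definition eR : expr :=
  let t := `0 / eN in
  let t' := t - 1 in
  let q := emod t' eN in
  ezero t * (eC `0 * epos aU.[`0]) +
  epos t * (eP * eK * aR.[`0 - eN] -
            eeq (etime q) t' * (aR.[t' * eN + q] * aW.[q * eN + emod `0 eN])).

(** The inner sum runs over the whole table, but entries not yet computed read as 0, which leaves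
    the columns accepted so far. The greedy tables below use the same device. *)
Definition eA : expr :=
  aF.[erev `0] * aBG.[erev `0] *
  EProd (bM) (1 - epos (eE `0 (erev `1)) *
    egt (2 * ESum (bN) (aA.[`0] * eE `1 (erev `0))) eP).

Definition eQ : expr :=
  aA.[erev (`0 / eK)] *
  (1 - ESum (bK) aQ.[`1 / eK * eK + `0]) *
  EProd (bM) (1 - (ESum (bN) (aQ.[`0 * eK + emod `2 eK] * eE `1 `0) +
                   eE `0 (`1 / eK) - eP)).

(* Under [d] binders the current index of the table is variable [d]. *)
Definition erem (d : nat) : expr :=
  aU.[erev (Var d / eK)] - ESum (bK) aX.[Var d.+1 / eK * eK + `0].

Definition eload : expr :=
  ESum (bN) (aQ.[`0 * eK + emod `2 eK] * eE `1 `0) +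
  ESum (bN) (aX.[`0 * eK + emod `2 eK] * eE `1 (erev `0)).

Definition eX : expr :=
  let j := erev (`0 / eK) in
  aF.[j] * ezero aBG.[j] *
  (erem 0 - EMax (bM) (let e := eE `0 (erev (`1 / eK)) in
                       epos e * (erem 1 - (eP - eload) / e))).

(** An integral row with entries [a] and right-hand side [b] becomes [2 * a] and [2 * b + 1]: this
    is equivalent for integral solutions, and the right-hand side is positive even if [b = 0]. [aP]
    is the product of these right-hand sides, so every row scales to it exactly. *)
Definition tables : seq stmt :=
  [:: In (BConst 2);
      Tab (BConst 1) (eM * eN);
      Tab (BConst 1) (aMN.[0] + eM + eN);
      Tab (BConst 1) (2 * aNP.[0] + eN);
      In (cell0 aLEN);
      Tab (BConst 1) (EProd (cell0 aNP) aIN.[2 * `0 + 1]);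
      Tab (cell0 aNP) (aIN.[2 * `0] * (aD.[0] / aIN.[2 * `0 + 1]));
      Tab (BConst 1) (EProd (bM) (2 * aVAL.[aMN.[0] + `0] + 1));
      Tab (cell0 aMN)
        (2 * aVAL.[`0] * (eP / (2 * aVAL.[aMN.[0] + `0 / eN] + 1)));
      Tab bN (EMax (bM) eE `0 `1);
      Tab bN eU;
      Tab (BConst 1) (Bin OMax 1 (EMax (bN) ESum (bM) epos (eE `0 `1)));
      Tab bN (egt (2 * aEM.[`0]) eP);
      Tab (BConst 1) (eN * eN);
      Tab (cell0 aNN) eW;
      Tab (BConst 1) (2 * aNN.[0]);
      Tab (cell0 aN2) eR;
      Tab bN (epos aR.[etime `0 * eN + `0]);
      Tab bN eA;
      Tab (BConst 1) (eN * eK);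
      Tab (cell0 aNK) eQ;
      Tab (cell0 aNK) eX;
      Tab bK (ESum (bN) (eC `0 * eQX `0 `1));
      Tab (BConst 1) (EMax (bK) aV.[`0]);
      Tab bK (ezero (aBV.[0] - aV.[`0]) * (1 - ESum (bK) aT.[`0]));
      Tab bN (ESum (bK) (aT.[`0] * eQX `1 `0))].

End Program.

Definition solver : program := compile tables bN.

Lemma tables_wf : all stmt_wf tables.
Proof. by vm_compute. Qed.

Lemma posE x : 1 - (1 - x) = (0 < x). Proof. by case: x. Qed.
Lemma zeroE x : 1 - x = (x == 0). Proof. by case: x. Qed.
Lemma subn_eqE x y : 1 - (x - y + (y - x)) = (x == y).
Proof. by case: eqP => [->|ne_xy]; lia. Qed.
Lemma prod_bool (m : nat) (p : pred 'I_m) :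
  \prod_(i < m) (p i : nat) = [forall i, p i].
Proof.
have [/forallP all_p|/forallPn[i /negPf p_i]] := boolP [forall i, p i].
  by rewrite big1 // => i _; rewrite all_p.
by rewrite (bigD1 i) //= p_i.
Qed.

Lemma divn_pair i n j : j < n -> (i * n + j) %/ n = i.
Proof. by move=> lt_j; rewrite divnMDl ?divn_small ?addn0 //; case: n lt_j. Qed.

Lemma modn_pair i n j : j < n -> i * n + j - (i * n + j) %/ n * n = j.
Proof. by move=> lt_j; rewrite divn_pair // addKn. Qed.

Lemma subn_modn x n : x - x %/ n * n = x %% n.
Proof. by rewrite [X in X - _](divn_eq x n) addKn. Qed.

Lemma ltn_pair i j m n : i < m -> j < n -> i * n + j < m * n.
Proof.
by move=> lt_i lt_j; apply: leq_trans (_ : i.+1 * n <= _);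
  rewrite ?leq_mul2r ?lt_i ?orbT // mulSn addnC ltn_add2r.
Qed.

Lemma eq_max n (F G : 'I_n -> nat) : F =1 G -> \max_(i < n) F i = \max_(i < n) G i.
Proof. by move=> eqFG; apply: eq_bigr. Qed.

Lemma sum_rev n (F : nat -> nat) : \sum_(j < n) F (n - 1 - j) = \sum_(j < n) F j.
Proof.
rewrite (reindex_inj rev_ord_inj); apply: eq_bigr => j _ /=; congr F.
by have := ltn_ord j; lia.
Qed.

(** * The entries of the tables in terms of the rounding argument *)

Section Entries.
Variables (w : word) (M : mem).
Hypothesis M_run : run_of w tables M.
Local Notation g := (get M).
Local Notation m := (g aHD 0).
Local Notation n := (g aHD 1).
Local Notation mn := (g aMN 0).
Local Notation np := (g aNP 0).
Local Notation K := (g aK 0).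
Local Notation P := (g aP 0).
Local Notation E := (fun i j => g aE (i * n + j)).
Local Notation u := (g aU).
Local Notation c := (fun j => g aVAL (mn + m + j)).

Lemma HD_entry x : g aHD x = if x < 2 then nth 0 w x else 0.
Proof. by have -> := in_entry (a := aHD) M_run x erefl isT isT. Qed.

Lemma MN_entry : mn = m * n.
Proof. exact: (tab_entry (a := aMN) (x := 0) M_run erefl isT isT isT). Qed.

Lemma NP_entry : np = mn + m + n.
Proof. exact: (tab_entry (a := aNP) (x := 0) M_run erefl isT isT isT). Qed.

Lemma LEN_entry : g aLEN 0 = 2 * np + n.
Proof. exact: (tab_entry (a := aLEN) (x := 0) M_run erefl isT isT isT). Qed.

Lemma IN_entry x : g aIN x = if x < g aLEN 0 then nth 0 (drop 2 w) x else 0.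
Proof. exact: (in_entry (a := aIN) M_run x erefl isT isT). Qed.

Lemma D_entry : g aD 0 = \prod_(x < np) g aIN (2 * x + 1).
Proof. exact: (tab_entry (a := aD) (x := 0) M_run erefl isT isT isT). Qed.

Lemma VAL_entry x : x < np ->
  g aVAL x = g aIN (2 * x) * (g aD 0 %/ g aIN (2 * x + 1)).
Proof. exact: (tab_entry (a := aVAL) M_run erefl isT isT). Qed.

Lemma P_entry : P = \prod_(i < m) (2 * g aVAL (mn + i) + 1).
Proof. exact: (tab_entry (a := aP) (x := 0) M_run erefl isT isT isT). Qed.

Lemma E_entry x : x < mn ->
  g aE x = 2 * g aVAL x * (P %/ (2 * g aVAL (mn + x %/ n) + 1)).
Proof. exact: (tab_entry (a := aE) M_run erefl isT isT). Qed.

Lemma EM_entry j : j < n -> g aEM j = col_max m E j.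
Proof. exact: (tab_entry (a := aEM) M_run erefl isT isT). Qed.

Lemma U_entry j : j < n -> let ub := g aIN (2 * np + j) in
  u j = (ub == 0) * (P %/ g aEM j) +
    (0 < ub) * ((g aEM j == 0) * (ub - 1) +
                (0 < g aEM j) * (ub - 1 - (ub - 1 - P %/ g aEM j))).
Proof.
move=> lt_j ub; rewrite -!posE -!zeroE.
exact: (tab_entry (a := aU) M_run erefl isT isT lt_j).
Qed.

Lemma K_entry : K = maxn 1 (\max_(j < n) support_size m E j).
Proof.
under eq_max => j do (rewrite /support_size; under eq_bigr do rewrite -posE).
exact: (tab_entry (a := aK) (x := 0) M_run erefl isT isT isT).
Qed.

Lemma BG_entry j : j < n -> g aBG j = is_big m P E j.
Proof.
move=> lt_j; rewrite /is_big -subn_gt0 -posE -EM_entry //.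
exact: (tab_entry (a := aBG) M_run erefl isT isT lt_j).
Qed.

Lemma NN_entry : g aNN 0 = n * n.
Proof. exact: (tab_entry (a := aNN) (x := 0) M_run erefl isT isT isT). Qed.

Lemma W_entry j j' : j < n -> j' < n ->
  g aW (j * n + j') = charge_of m K P E u j j'.
Proof.
move=> lt_j lt_j'; set x := j * n + j'.
have lt_x : x < g aNN 0 by rewrite NN_entry ltn_pair.
have -> : g aW x =
    (g aBG (x %/ n) * (2 * K) + (1 - g aBG (x %/ n)) * u (x %/ n)) *
    \sum_(i < m) (1 - (1 - E i (x %/ n))) * E i (x - x %/ n * n).
  exact: (tab_entry (a := aW) M_run erefl isT isT lt_x).
rewrite modn_pair // divn_pair // BG_entry // /charge_of /gain; congr (_ * _).
  by case: (is_big _ _ _ _); rewrite ?mul1n ?mul0n ?addn0.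
by apply: eq_bigr => i _; rewrite posE.
Qed.

Lemma N2_entry : g aN2 0 = 2 * g aNN 0.
Proof. exact: (tab_entry (a := aN2) (x := 0) M_run erefl isT isT isT). Qed.

Lemma R_entry x : x < g aN2 0 ->
  g aR x =
  (1 - x %/ n) * (g aVAL (mn + m + x) * (1 - (1 - u x))) +
  (1 - (1 - x %/ n)) *
  (P * K * ((x - n < x) * g aR (x - n)) -
   let t := x %/ n - 1 in let q := t - t %/ n * n in
   (1 - ((g aBG q * n + q - t) + (t - (g aBG q * n + q)))) *
   ((t * n + q < x) * g aR (t * n + q) * g aW (q * n + (x - x %/ n * n)))).
Proof. exact: (tab_entry (a := aR) M_run erefl isT isT). Qed.

Lemma R_residual t j : t < 2 * n -> j < n ->
  g aR (t * n + j) = residual m n K P E u c t j.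
Proof.
elim: t j => [|t IH] j lt_t lt_j; have n_gt0 : 0 < n by lia.
  rewrite R_entry; last by rewrite N2_entry NN_entry mulnA ltn_pair.
  by rewrite mul0n add0n divn_small // posE residual0 addn0 mul1n.
rewrite R_entry; last by rewrite N2_entry NN_entry mulnA ltn_pair.
rewrite /= modn_pair // divn_pair // subn1 /= residualS subn_modn subn_eqE.
have lt_tn : t %% n < n by rewrite ltn_pmod.
have -> : t.+1 * n + j - n = t * n + j by rewrite mulSn; lia.
rewrite IH ?IH ?W_entry ?BG_entry //; try lia.
(* Both cells read by the recursion precede the current one, so they are visible. *)
have -> : t * n + j < t.+1 * n + j by rewrite mulSn; lia.
have -> : t * n + t %% n < t.+1 * n + j by rewrite mulSn; lia.
by rewrite !mul1n add0n.
Qed.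

Lemma F_entry j : j < n -> g aF j = flagged m n K P E u c j.
Proof.
move=> lt_j; have -> : g aF j = 1 - (1 - g aR ((g aBG j * n + j) * n + j)).
  exact: (tab_entry (a := aF) M_run erefl isT isT lt_j).
rewrite BG_entry // posE R_residual //.
exact: (@time_lt m n P E).
Qed.

Lemma A_entry j : j < n ->
  g aA (n - 1 - j) = accepts m n K P E u c (fun j => g aA (n - 1 - j)) j.
Proof.
move=> lt_j; set s := n - 1 - j; have lt_s : s < n by lia.
have eq_j : n - 1 - s = j by lia.
have -> : g aA s = g aF (n - 1 - s) * g aBG (n - 1 - s) *
    \prod_(i < m) (1 - (1 - (1 - E i (n - 1 - s))) *
      (1 - (1 - (2 * (\sum_(s' < n) (s' < s) * g aA s' * E i (n - 1 - s')) - P)))).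
  exact: (tab_entry (a := aA) M_run erefl isT isT lt_s).
rewrite eq_j F_entry // BG_entry // !mulnb /accepts andbA.
under eq_bigr => i _.
  rewrite !posE mulnb zeroE eqb0 negb_and -implybE subn_gt0 -leqNgt.
  (* In the reversed table the visible entries [s' < s] are the columns [j' > j]. *)
  have -> : \sum_(s' < n) (s' < s) * g aA s' * E i (n - 1 - s') =
    \sum_(j' < n | j < j') g aA (n - 1 - j') * E i j'.
    pose G j' := (n - 1 - j' < s) * g aA (n - 1 - j') * E i j'.
    rewrite (eq_bigr (fun s' : 'I_n => G (n - 1 - s'))); last first.
      move=> s' _; rewrite /G; have := ltn_ord s' => lt_s'.
      by have -> : n - 1 - (n - 1 - s') = s' by lia.
    rewrite sum_rev [RHS]big_mkcond; apply: eq_bigr => j' _; rewrite /G.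
    have -> : (n - 1 - j' < s) = (j < j') by have := ltn_ord j'; lia.
    by case: (j < j'); rewrite ?mul1n.
  over.
by rewrite prod_bool mulnb.
Qed.

Lemma NK_entry : g aNK 0 = n * K.
Proof. exact: (tab_entry (a := aNK) (x := 0) M_run erefl isT isT isT). Qed.

Lemma Q_entry j k : j < n -> k < K ->
  g aQ (j * K + k) = [&& 0 < g aA (n - 1 - j),
    \sum_(k' < K | k' < k) g aQ (j * K + k') == 0 &
    class_fits m n P E (fun j k => g aQ (j * K + k)) j k].
Proof.
move=> lt_j lt_k; set x := j * K + k.
have lt_x : x < g aNK 0 by rewrite NK_entry ltn_pair.
have -> : g aQ x = g aA (n - 1 - x %/ K) *
    (1 - \sum_(k' < K) (x %/ K * K + k' < x) * g aQ (x %/ K * K + k')) *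
    \prod_(i < m) (1 - ((\sum_(j' < n)
       ((j' * K + (x - x %/ K * K) < x) * g aQ (j' * K + (x - x %/ K * K))) *
       E i j') + E i (x %/ K) - P)).
  exact: (tab_entry (a := aQ) M_run erefl isT isT lt_x).
rewrite modn_pair // divn_pair // zeroE A_entry // lt0b.
rewrite !mulnb; set S := \sum_(k' < K) _.
have -> : S = \sum_(k' < K | k' < k) g aQ (j * K + k').
  rewrite /S [RHS]big_mkcond; apply: eq_bigr => k' _; rewrite ltn_add2l.
  by case: (k' < k); rewrite ?mul1n.
under [\prod_(_ < _) _]eq_bigr => i _.
  rewrite zeroE subn_eq0.
  have -> : \sum_(j' < n) (j' * K + k < x) * g aQ (j' * K + k) * E i j' =
    \sum_(j' < n | j' < j) g aQ (j' * K + k) * E i j'.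
    rewrite [RHS]big_mkcond; apply: eq_bigr => j' _.
    rewrite ltn_add2r ltn_pmul2r; last by lia.
    by case: (j' < j); rewrite ?mul1n.
  over.
by rewrite prod_bool mulnb andbA.
Qed.

Lemma X_entry j k : j < n -> k < K ->
  let Q j k := g aQ (j * K + k) in
  let X j k := g aX ((n - 1 - j) * K + k) in
  X j k = (flagged m n K P E u c j && ~~ is_big m P E j) *
    (remaining K u X j k - \max_(i < m) (0 < E i j) *
       (remaining K u X j k - (P - load n E Q X i j k) %/ E i j)).
Proof.
move=> lt_j lt_k Q X; rewrite {1}/X.
set s := n - 1 - j; set x := s * K + k; have lt_s : s < n by lia.
have eq_j : n - 1 - s = j by lia.
have lt_x : x < g aNK 0 by rewrite NK_entry ltn_pair.
have -> : g aX x = g aF (n - 1 - x %/ K) * (1 - g aBG (n - 1 - x %/ K)) *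
    (u (n - 1 - x %/ K) -
     \sum_(k' < K) (x %/ K * K + k' < x) * g aX (x %/ K * K + k') -
     \max_(i < m) (1 - (1 - E i (n - 1 - x %/ K))) *
       (u (n - 1 - x %/ K) -
        \sum_(k' < K) (x %/ K * K + k' < x) * g aX (x %/ K * K + k') -
        (P - (\sum_(j' < n) g aQ (j' * K + (x - x %/ K * K)) * E i j' +
              \sum_(s' < n) (s' * K + (x - x %/ K * K) < x) *
                g aX (s' * K + (x - x %/ K * K)) * E i (n - 1 - s')))
        %/ E i (n - 1 - x %/ K))).
  exact: (tab_entry (a := aX) M_run erefl isT isT lt_x).
rewrite modn_pair // divn_pair // eq_j F_entry // BG_entry // zeroE eqb0 mulnb.
have -> : u j - \sum_(k' < K) (s * K + k' < x) * g aX (s * K + k') =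
    remaining K u X j k.
  rewrite /remaining; congr (_ - _); rewrite [RHS]big_mkcond; apply: eq_bigr => k' _.
  by rewrite ltn_add2l; case: (k' < k); rewrite ?mul1n.
congr (_ * (_ - _)); apply: eq_bigr => i _; rewrite posE /load.
congr (_ * (_ - (_ - (_ + _)) %/ _)).
pose G j' := ((n - 1 - j') * K + k < x) * X j' k * E i j'.
rewrite (eq_bigr (fun s' : 'I_n => G (n - 1 - s'))); last first.
  move=> s' _; rewrite /G /X; have := ltn_ord s' => lt_s'.
  by have -> : n - 1 - (n - 1 - s') = s' by lia.
rewrite sum_rev [RHS]big_mkcond; apply: eq_bigr => j' _; rewrite /G.
rewrite ltn_add2r ltn_pmul2r; last by lia.
have -> : (n - 1 - j' < s) = (j < j') by have := ltn_ord j'; lia.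
by case: (j < j'); rewrite ?mul1n.
Qed.

Local Notation sol := (solution (fun j k => g aQ (j * K + k))
                                (fun j k => g aX ((n - 1 - j) * K + k))).

Lemma V_entry k : k < K -> g aV k = \sum_(j < n) c j * sol k j.
Proof. exact: (tab_entry (a := aV) M_run erefl isT isT). Qed.

Lemma BV_entry : g aBV 0 = \max_(k < K) g aV k.
Proof. exact: (tab_entry (a := aBV) (x := 0) M_run erefl isT isT isT). Qed.

Lemma T_entry k : k < K ->
  g aT k = (g aBV 0 <= g aV k) && (\sum_(k' < K | k' < k) g aT k' == 0) :> nat.
Proof.
move=> lt_k; have -> : g aT k = (1 - (g aBV 0 - g aV k)) *
    (1 - \sum_(k' < K) (k' < k) * g aT k').
  exact: (tab_entry (a := aT) M_run erefl isT isT lt_k).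
rewrite !zeroE mulnb subn_eq0; congr (nat_of_bool (_ && (_ == 0))).
by rewrite [RHS]big_mkcond; apply: eq_bigr => k' _; case: (k' < k); rewrite ?mul1n.
Qed.

Lemma OUT_entry j : j < n -> g aOUT j = \sum_(k < K) g aT k * sol k j.
Proof. exact: (tab_entry (a := aOUT) M_run erefl isT isT). Qed.

End Entries.

(** * Correctness on encoded programs *)

Import Order.TTheory GRing.Theory Num.Theory.

Lemma size_flatten_rat (s : seq rat) : size (flatten (map encode_rat s)) = 2 * size s.
Proof. by elim: s => //= q s ->; lia. Qed.

Lemma nth_flatten_rat (s : seq rat) x : x < size s ->
  nth 0 (flatten (map encode_rat s)) (2 * x) = `|numq (nth 0%R s x)|%N /\
  nth 0 (flatten (map encode_rat s)) (2 * x + 1) = `|denq (nth 0%R s x)|%N.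
Proof.
elim: s x => // q s IH [|x] lt_x //.
have -> : 2 * x.+1 = (2 * x).+2 by lia.
exact: IH.
Qed.

Lemma nth_pairs (S T U : Type) (x0 : S) (y0 : T) (z0 : U) (f : S -> T -> U) s t i j :
  i < size s -> j < size t ->
  nth z0 (flatten [seq [seq f x y | y <- t] | x <- s]) (i * size t + j) =
  f (nth x0 s i) (nth y0 t j).
Proof.
move=> + lt_j; elim: s i => // x s IH [|i] /= lt_i; rewrite nth_cat size_map.
  by rewrite mul0n add0n lt_j (nth_map y0).
by rewrite mulSn -addnA ltnNge leq_addr addKn IH.
Qed.

Section Encoding.
Variable I : pip.
Local Notation m := (nrows I).
Local Notation n := (ncols I).

(** With all rationals in one list, the numerator and denominator of number [x] are the input
    entries [2 * x] and [2 * x + 1]. *)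
Definition pip_rats : seq rat :=
  [seq cmat I i j | i <- enum 'I_m, j <- enum 'I_n] ++
  [seq rhs I i 0%R | i <- enum 'I_m] ++ [seq obj I 0%R j | j <- enum 'I_n].

Lemma encode_pipE : encode_pip I =
  [:: m; n] ++ flatten (map encode_rat pip_rats) ++
  [seq encode_ubound (ubound I j) | j <- enum 'I_n].
Proof.
rewrite /encode_pip /pip_rats !map_cat !flatten_cat -!catA map_allpairs.
by rewrite -!map_comp.
Qed.

Lemma size_pip_rats : size pip_rats = m * n + m + n.
Proof.
rewrite /pip_rats !size_cat size_allpairs [size (map _ (enum 'I_m))]size_map.
by rewrite [size (map _ _)]size_map !size_enum_ord addnA.
Qed.

Lemma nth_cmat (i : 'I_m) (j : 'I_n) : nth 0%R pip_rats (i * n + j) = cmat I i j.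
Proof.
rewrite /pip_rats nth_cat size_allpairs !size_enum_ord ltn_pair //.
have := @nth_pairs _ _ _ i j 0%R (cmat I) (enum 'I_m) (enum 'I_n) i j.
by rewrite !size_enum_ord !nth_ord_enum => ->.
Qed.

Lemma nth_rhs (i : 'I_m) : nth 0%R pip_rats (m * n + i) = rhs I i 0%R.
Proof.
rewrite /pip_rats nth_cat size_allpairs !size_enum_ord ltnNge leq_addr addKn.
by rewrite nth_cat size_map size_enum_ord ltn_ord (nth_map i) ?size_enum_ord //
  nth_ord_enum.
Qed.

Lemma nth_obj (j : 'I_n) : nth 0%R pip_rats (m * n + m + j) = obj I 0%R j.
Proof.
rewrite /pip_rats nth_cat size_allpairs !size_enum_ord -addnA ltnNge leq_addr addKn.
rewrite nth_cat size_map size_enum_ord ltnNge leq_addr addKn.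
by rewrite (nth_map j) ?size_enum_ord // nth_ord_enum.
Qed.

Lemma pip_rats_ge0 q : q \in pip_rats -> (0 <= q)%R.
Proof.
rewrite !mem_cat => /or3P[/allpairsP[[i j] [_ _ ->]]|/mapP[i _ ->]|/mapP[j _ ->]].
- exact: cmat_ge0.
- exact: rhs_ge0.
- exact: obj_ge0.
Qed.

Variable M : mem.
Hypothesis M_run : run_of (encode_pip I) tables M.
Local Notation g := (get M).

Lemma get_m : g aHD 0 = m.
Proof. by rewrite (HD_entry M_run) encode_pipE. Qed.

Lemma get_n : g aHD 1 = n.
Proof. by rewrite (HD_entry M_run) encode_pipE. Qed.

Lemma get_mn : g aMN 0 = m * n.
Proof. by rewrite (MN_entry M_run) get_m get_n. Qed.

Lemma get_np : g aNP 0 = m * n + m + n.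
Proof. by rewrite (NP_entry M_run) get_mn get_m get_n. Qed.

Lemma get_IN x : x < 2 * (m * n + m + n) + n ->
  g aIN x = nth 0 (flatten (map encode_rat pip_rats) ++
                   [seq encode_ubound (ubound I j) | j <- enum 'I_n]) x.
Proof.
move=> lt_x; rewrite (IN_entry M_run) (LEN_entry M_run) get_np get_n lt_x encode_pipE.
by rewrite /= drop0.
Qed.

Lemma get_rat x : x < m * n + m + n ->
  g aIN (2 * x) = `|numq (nth 0%R pip_rats x)|%N /\
  g aIN (2 * x + 1) = `|denq (nth 0%R pip_rats x)|%N.
Proof.
move=> lt_x; rewrite !get_IN; try lia.
have [|<- <-] := @nth_flatten_rat pip_rats x; first by rewrite size_pip_rats.
by split; rewrite nth_cat size_flatten_rat size_pip_rats ifT //; lia.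
Qed.

Lemma get_ubound (j : 'I_n) :
  g aIN (2 * (m * n + m + n) + j) = encode_ubound (ubound I j).
Proof.
rewrite get_IN ?ltn_add2l // nth_cat size_flatten_rat size_pip_rats ltnNge leq_addr.
by rewrite addKn (nth_map j) ?size_enum_ord // nth_ord_enum.
Qed.

Lemma D_gt0 : 0 < g aD 0.
Proof.
rewrite (D_entry M_run) get_np prodn_gt0 // => x.
by have [_ ->] := get_rat (ltn_ord x); rewrite absz_gt0.
Qed.

Lemma den_dvd_D x : x < m * n + m + n -> g aIN (2 * x + 1) %| g aD 0.
Proof.
move=> lt_x; rewrite (D_entry M_run) get_np (bigD1 (Ordinal lt_x)) //=.
exact: dvdn_mulr.
Qed.

(** [aD] is the product of all denominators, so its division by one of them is exact. *)
Lemma get_VAL x : x < m * n + m + n ->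
  ((g aVAL x)%:R = nth 0 pip_rats x * (g aD 0)%:R :> rat)%R.
Proof.
move=> lt_x; have [eq_num eq_den] := get_rat lt_x.
have := den_dvd_D lt_x; rewrite (VAL_entry M_run) ?get_np // eq_num eq_den.
set q := nth _ _ _ => /dvdnP[d ->].
have q_ge0 : (0 <= q)%R by apply/pip_rats_ge0/mem_nth; rewrite size_pip_rats.
have den_gt0 : 0 < `|denq q|%N by rewrite absz_gt0.
rewrite mulnK // -{2}[q]divq_num_den !natrM.
have -> : ((`|numq q|%N)%:R = (numq q)%:~R :> rat)%R.
  by rewrite natr_absz ger0_norm ?numq_ge0.
have -> : ((`|denq q|%N)%:R = (denq q)%:~R :> rat)%R.
  by rewrite natr_absz normr_denq.
have nz : ((denq q)%:~R != 0 :> rat)%R by rewrite intr_eq0.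
by rewrite [(d%:R * _)%R]mulrC mulrA divfK.
Qed.

Definition entries (y : 'cV[nat]_n) : nat -> nat := nth 0 (encode_solution y).

Lemma entriesE y (j : 'I_n) : entries y j = y j 0%R.
Proof. by rewrite /entries (nth_map j) ?size_enum_ord // nth_ord_enum. Qed.

Local Notation E := (fun i j => g aE (i * g aHD 1 + j)).
Local Notation P := (g aP 0).
Local Notation val i j := (g aVAL (i * n + j)).
Local Notation den i := (2 * g aVAL (m * n + i) + 1).

Lemma P_gt0 : 0 < P.
Proof. by rewrite (P_entry M_run) prodn_gt0 // => i; rewrite addn1. Qed.

Lemma den_dvd_P (i : 'I_m) : den i %| P.
Proof.
rewrite (P_entry M_run) get_m get_mn (bigD1 i) //=; exact: dvdn_mulr.
Qed.

Lemma get_E (i : 'I_m) (j : 'I_n) : E i j = 2 * val i j * (P %/ den i).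
Proof.
rewrite get_n (E_entry M_run) ?get_mn ?ltn_pair // get_n divn_pair //.
Qed.

Lemma row_scale_gt0 (i : 'I_m) : 0 < P %/ den i.
Proof.
by rewrite divn_gt0 ?addn1 // -addn1 dvdn_leq ?P_gt0 ?den_dvd_P.
Qed.

Lemma E_gt0 (i : 'I_m) (j : 'I_n) : (0 < E i j) = (cmat I i j != 0%R).
Proof.
rewrite /= get_E muln_gt0 row_scale_gt0 andbT muln_gt0 /=.
rewrite -(ltr_nat rat) get_VAL ?nth_cmat; last first.
  by have := ltn_pair (ltn_ord i) (ltn_ord j); lia.
rewrite pmulr_lgt0 ?ltr0n ?D_gt0 // lt0r; case: eqP => //= _; exact: cmat_ge0.
Qed.

(** Cancelling the factor [P %/ den i] leaves [2 * S <= 2 * b + 1], which for natural numbers means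
    [S <= b]; dividing by [aD] gives the rational row. *)
Lemma row_fitsE (z : nat -> nat) (i : 'I_m) :
  (\sum_(j < n) z j * E i j <= P) =
  (\sum_j cmat I i j * (z j)%:R <= rhs I i 0 :> rat)%R.
Proof.
have -> : \sum_(j < n) z j * E i j =
    2 * (\sum_(j < n) val i j * z j) * (P %/ den i).
  rewrite big_distrr big_distrl /=; apply: eq_bigr => j _; rewrite /= get_E; nia.
rewrite -[X in _ <= X](divnK (den_dvd_P i)) [leqRHS]mulnC leq_mul2r.
have -> : (P %/ den i == 0) = false by have := row_scale_gt0 i; lia.
have lt_i : m * n + i < m * n + m + n by have := ltn_ord i; lia.
rewrite /= -(ler_pM2r (_ : (0 < (g aD 0)%:R :> rat)%R)) ?ltr0n ?D_gt0 //.
rewrite -nth_rhs -get_VAL // mulr_suml.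
have -> : (\sum_j cmat I i j * (z j)%:R * (g aD 0)%:R =
    (\sum_(j < n) val i j * z j)%N%:R :> rat)%R.
  rewrite natr_sum; apply: eq_bigr => j _; rewrite natrM get_VAL.
    by rewrite nth_cmat mulrAC.
  by have := ltn_pair (ltn_ord i) (ltn_ord j); lia.
rewrite ler_nat; set S := \sum_(j < n) _.
apply/idP/idP; lia.
Qed.

Local Notation c := (fun j => g aVAL (g aMN 0 + g aHD 0 + j)).

Lemma objectiveE (y : 'cV[nat]_n) :
  ((\sum_(j < n) c j * entries y j)%N%:R = objective y * (g aD 0)%:R :> rat)%R.
Proof.
rewrite natr_sum /objective mulr_suml; apply: eq_bigr => j _.
rewrite natrM entriesE get_mn get_m get_VAL; first by rewrite nth_obj mulrAC.
by have := ltn_ord j; lia.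
Qed.

End Encoding.

(** * Feasibility and approximation ratio of the output *)

Section Instance.
Variables (I : pip) (M : mem).
Hypothesis M_run : run_of (encode_pip I) tables M.
Local Notation g := (get M).
Local Notation E := (fun i j => g aE (i * g aHD 1 + j)).
Local Notation P := (g aP 0).
Local Notation K := (g aK 0).
Local Notation u := (g aU).
Local Notation c := (fun j => g aVAL (g aMN 0 + g aHD 0 + j)).
Local Notation Q := (fun j k => g aQ (j * K + k)).
Local Notation X := (fun j k => g aX ((g aHD 1 - 1 - j) * K + k)).
Local Notation A := (fun j => g aA (g aHD 1 - 1 - j)).
Local Notation sol := (solution Q X).
Local Notation ub j := (g aIN (2 * g aNP 0 + j)).

Lemma sum_get_n (F : nat -> nat) :
  \sum_(j < g aHD 1) F j = \sum_(j < ncols I) F j.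
Proof. by rewrite (get_n M_run). Qed.

Lemma E_le_EM i j : i < g aHD 0 -> j < g aHD 1 -> E i j <= g aEM j.
Proof.
move=> lt_i lt_j; rewrite (EM_entry M_run) // /col_max.
exact: (leq_bigmax (F := fun i : 'I_(g aHD 0) => E i j) (Ordinal lt_i)).
Qed.

Lemma K_gt0 : 0 < K.
Proof. by rewrite (K_entry M_run) leq_max. Qed.

Lemma u_le_div j : j < g aHD 1 -> 0 < g aEM j -> u j <= P %/ g aEM j.
Proof.
move=> lt_j EM_gt0; rewrite (U_entry M_run) // EM_gt0.
have -> : (g aEM j == 0) = false by lia.
case: (ub j) => [|d]; rewrite /= ?mul0n ?mul1n ?add0n ?addn0 //.
by rewrite leq_subCl.
Qed.

Lemma u_fits i j : i < g aHD 0 -> j < g aHD 1 -> u j * E i j <= P.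
Proof.
move=> lt_i lt_j; have le_E := E_le_EM lt_i lt_j.
have [->|E_gt0] := posnP (E i j); first by rewrite muln0.
have EM_gt0 : 0 < g aEM j by apply: leq_trans le_E.
apply: leq_trans (leq_mul (u_le_div lt_j EM_gt0) le_E) _.
exact: leq_trunc_div.
Qed.

Lemma u_le_ubound (j : 'I_(ncols I)) :
  if ubound I j is Some d then u j <= d else true.
Proof.
have lt_j : j < g aHD 1 by rewrite (get_n M_run).
have := get_ubound M_run j; rewrite -(get_np M_run) => ub_j.
case: (ubound I j) ub_j => //= d ub_j; rewrite (U_entry M_run) // ub_j.
by rewrite /= mul0n mul1n; case: (g aEM j) => [|e]; rewrite /= ?mul0n ?mul1n; lia.
Qed.

Lemma support_le j : j < g aHD 1 ->
  support_size (g aHD 0) E j <= \max_(j < g aHD 1) support_size (g aHD 0) E j.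
Proof.
move=> lt_j.
exact: (leq_bigmax (F := fun j : 'I_(g aHD 1) => support_size (g aHD 0) E j)
                   (Ordinal lt_j)).
Qed.

Lemma supportK j : j < g aHD 1 -> support_size (g aHD 0) E j <= K.
Proof.
by move=> lt_j; rewrite (K_entry M_run) leq_max support_le ?orbT.
Qed.

(** [aT] marks the first class attaining the maximal value [aBV]; there is one because [K] is
    positive. *)
Lemma best_class : exists k0 : 'I_K,
  (forall j, j < g aHD 1 -> g aOUT j = sol k0 j) /\
  forall k : 'I_K, g aV k <= g aV k0.
Proof.
have [|k0 [le_k0 T1 T0]] := @first_fit K (fun k => g aBV 0 <= g aV k) (g aT)
  (T_entry M_run).
  have [|k max_k] := @bigop.eq_bigmax _ (fun k : 'I_K => g aV k).
    by rewrite card_ord K_gt0.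
  by exists k; rewrite (BV_entry M_run) max_k.
exists k0; split=> [j lt_j|k].
  rewrite (OUT_entry M_run) // (bigD1 k0) //= T1 mul1n big1 ?addn0 // => k neq_k.
  by rewrite T0.
apply: leq_trans le_k0; rewrite (BV_entry M_run).
exact: (leq_bigmax (F := fun k : 'I_K => g aV k)).
Qed.

Definition out_vector : 'cV[nat]_(ncols I) := \col_j g aOUT j.

Lemma out_vectorE : mkseq (g aOUT) (g aHD 1) = encode_solution out_vector.
Proof.
rewrite (get_n M_run) /mkseq -val_enum_ord -map_comp /encode_solution.
by apply: eq_map => j; rewrite mxE.
Qed.

Lemma out_feasible : feasible out_vector.
Proof.
have [k0 [out_k0 _]] := best_class.
split=> [i|j].
  have lt_i : i < g aHD 0 by rewrite (get_m M_run).
  have := @solution_fits (g aHD 0) (g aHD 1) K P E u c A Q X (P_gt0 M_run) K_gt0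
    (Q_entry M_run) (X_entry M_run) k0 i (ltn_ord k0) lt_i.
  rewrite (sum_get_n (fun j => sol k0 j * E i j)) (row_fitsE M_run).
  congr (_ <= _)%R; apply: eq_bigr => j _; rewrite mxE out_k0 //.
  by rewrite (get_n M_run).
have lt_j : j < g aHD 1 by rewrite (get_n M_run).
have := u_le_ubound j; case: (ubound I j) => // d; apply: leq_trans.
rewrite mxE out_k0 //.
exact: (@solution_le_u (g aHD 0) (g aHD 1) K P E u c A Q X (A_entry M_run)
  (Q_entry M_run) (X_entry M_run)).
Qed.

(* A column without entries and without upper bound makes the program
   unbounded, unless its cost is 0. *)
Lemma optimal_free_column (y : 'cV[nat]_(ncols I)) (j : 'I_(ncols I)) : optimal y ->
  g aEM j = 0 -> ub j = 0 -> c j = 0.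
Proof.
have lt_j : j < g aHD 1 by rewrite (get_n M_run).
move=> [[fits_y le_y] opt_y] EM0 ub0; apply/eqP; rewrite -(eqr_nat rat).
rewrite (get_mn M_run) (get_m M_run) (get_VAL M_run); last by have := ltn_ord j; lia.
rewrite nth_obj mulf_eq0; apply/orP; left.
have cmat0 i : cmat I i j = 0%R.
  apply/eqP; apply/negPn; rewrite -(E_gt0 M_run) -leqNgt.
  have lt_i : i < g aHD 0 by rewrite (get_m M_run).
  by apply: leq_trans (E_le_EM lt_i lt_j) _; rewrite EM0.
pose y' : 'cV[nat]_(ncols I) := (\col_l (y l 0%R + (l == j))%N)%R.
have obj_y' : objective y' = (objective y + obj I 0 j)%R.
  rewrite /objective (bigD1 j) // [X in (_ = X + _)%R](bigD1 j) //= mxE eqxx.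
  rewrite natrD mulrDr mulr1 addrAC; congr (_ + _ + _)%R.
  by apply: eq_bigr => j' neq_j; rewrite mxE (negPf neq_j) addn0.
have /opt_y : feasible y'.
  split=> [i|j'].
    apply: le_trans (fits_y i); rewrite le_eqVlt; apply/orP; left; apply/eqP.
    apply: eq_bigr => j' _; rewrite mxE; have [->|] := eqVneq j' j.
      by rewrite cmat0 !mul0r.
    by rewrite addn0.
  have := le_y j'; rewrite mxE; have [->|] := eqVneq j' j; last by rewrite addn0.
  have := get_ubound M_run j; rewrite -(get_np M_run) ub0.
  by case: (ubound I j).
rewrite obj_y' gerDl => le0; apply/eqP/le_anti.
by rewrite le0 obj_ge0.
Qed.

(** The algorithm works with the sparsity [kappa] of the matrix itself; [k] enters through
    [kappa <= k] at the end. *)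
Lemma out_approx k (y : 'cV[nat]_(ncols I)) : column_sparse k I -> optimal y ->
  \sum_(j < ncols I) c j * entries y j <=
  (2 * k ^ 2 + 2) * \sum_(j < ncols I) c j * entries out_vector j.
Proof.
move=> sparse opt_y; have [[fits_y le_y] _] := opt_y.
have [k0 [out_k0 best_k0]] := best_class.
(* A column with neither entries nor bound has [u j = 0] but may be positive in [y]. Its cost is 0
   because an optimum exists, so it is removed. *)
pose z j := if (g aEM j == 0) && (ub j == 0) then 0 else entries y j.
have z_le j : z j <= entries y j by rewrite /z; case: ifP.
have fits_entries i : i < g aHD 0 -> \sum_(j < g aHD 1) entries y j * E i j <= P.
  rewrite (get_m M_run) => lt_i.
  rewrite (sum_get_n (fun j => entries y j * E i j)).
  rewrite (row_fitsE M_run (entries y) (Ordinal lt_i)).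
  apply: le_trans (fits_y (Ordinal lt_i)).
  by rewrite le_eqVlt; apply/orP; left; apply/eqP; apply: eq_bigr => j _;
    rewrite entriesE.
have z_fits i : i < g aHD 0 -> \sum_(j < g aHD 1) z j * E i j <= P.
  move=> lt_i; apply: leq_trans (fits_entries i lt_i); apply: leq_sum => j _.
  by rewrite leq_mul2r z_le orbT.
have z_le_u j : j < g aHD 1 -> z j <= u j.
  move=> lt_j; have lt_jI : j < ncols I by rewrite -(get_n M_run).
  have le_div : 0 < g aEM j -> entries y j <= P %/ g aEM j.
    move=> EM_gt0; rewrite leq_divRL // (EM_entry M_run) // /col_max.
    have [->|e_gt0] := posnP (entries y j); first by rewrite mul0n.
    rewrite mulnC -leq_divRL //; apply/bigmax_leqP => i _; rewrite leq_divRL // mulnC.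
    apply: leq_trans (fits_entries i (ltn_ord i)).
    by rewrite (bigD1 (Ordinal lt_j)) //= leq_addr.
  have le_ub : 0 < ub j -> entries y j <= ub j - 1.
    have := get_ubound M_run (Ordinal lt_jI); rewrite -(get_np M_run) /= => ->.
    have := le_y (Ordinal lt_jI); rewrite -entriesE /=.
    by case: (ubound I _) => //= d; lia.
  rewrite (U_entry M_run) // /z; case: (posnP (g aEM j)) => [EM0|EM_gt0].
    rewrite EM0 /= div.divn0; case: (posnP (ub j)) => [->//|ub_gt0].
    by rewrite mul0n !mul1n addn0 le_ub.
  have := le_div EM_gt0; have := le_ub.
  by case: (ub j) => [|d] /=; rewrite ?mul0n ?mul1n; lia.
have cz : \sum_(j < ncols I) c j * entries y j = \sum_(j < ncols I) c j * z j.
  apply: eq_bigr => j _; rewrite /z; case: ifP => // /andP[/eqP EM0 /eqP ub0].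
  by rewrite /= (optimal_free_column opt_y EM0 ub0).
set kappa := \max_(j < g aHD 1) support_size (g aHD 0) E j.
have K_kappa : K = maxn 1 kappa by rewrite (K_entry M_run).
have le_kappa : kappa <= k.
  apply/bigmax_leqP => j _; have lt_j : j < ncols I by rewrite -(get_n M_run).
  apply: leq_trans (sparse (Ordinal lt_j)); rewrite -sum1dep_card big_mkcond /=.
  rewrite /support_size (get_m M_run) leq_eqVlt; apply/orP; left; apply/eqP.
  apply: eq_bigr => i _; have := E_gt0 M_run i (Ordinal lt_j) => /= ->.
  by case: (_ == _).
(* The least factor allowed by the two conditions: [max 4 (2 * kappa)], or 2 if the matrix is 0. *)
pose C := if kappa <= 1 then 2 + 2 * kappa else 2 * kappa.
have C_small : 2 * (K + kappa) <= C * K.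
  by rewrite K_kappa /C; case: (kappa) => [|[|x]] //=; rewrite (maxn_idPr _) //; nia.
have C_big : 0 < kappa -> 2 * K <= C.
  by rewrite K_kappa /C; case: (kappa) => [|[|x]] //=; rewrite (maxn_idPr _).
have CK : C * K <= 2 * k ^ 2 + 2.
  rewrite K_kappa /C; case: (kappa) le_kappa => [|[|x]] //= le_k; rewrite -mulnn.
  - by lia.
  - by nia.
  - by rewrite (maxn_idPr _) //; nia.
have := @total_approx (g aHD 0) (g aHD 1) K P E u c A Q X (P_gt0 M_run) K_gt0
    supportK u_fits (A_entry M_run) (Q_entry M_run) (X_entry M_run) z kappa C
    z_le_u z_fits support_le C_small C_big.
rewrite (sum_get_n (fun j => c j * z j)) -cz => /leq_trans; apply.
rewrite (sum_get_n (fun j => c j * total K Q X j)).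
have -> : \sum_(j < ncols I) c j * entries out_vector j = g aV k0.
  rewrite (V_entry M_run) // (sum_get_n (fun j => c j * sol k0 j)).
  apply: eq_bigr => j _; rewrite entriesE mxE out_k0 //.
  by rewrite (get_n M_run).
have -> : \sum_(j < ncols I) c j * total K Q X j = \sum_(k < K) g aV k.
  rewrite /total; under eq_bigr => j _ do rewrite big_distrr /=.
  rewrite exchange_big; apply: eq_bigr => k' _.
  by rewrite (V_entry M_run) // (sum_get_n (fun j => c j * sol k' j)).
apply: leq_trans (leq_mul CK (leqnn _)); rewrite -mulnA leq_mul2l; apply/orP; right.
(* The [K] classes together are worth at most [K] times the best one. *)
apply: leq_trans (leq_sum _ (fun k' _ => best_k0 k')) _.
by rewrite sum_nat_const card_ord.
Qed.

Lemma out_vector_approx k : column_sparse k I ->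
  approx_solution (2 * k%:R ^+ 2 + 2)%R out_vector.
Proof.
move=> sparse; split=> [|y opt_y]; first exact: out_feasible.
have alpha_gt0 : (0 < 2 * k%:R ^+ 2 + 2 :> rat)%R.
  by rewrite ltr_wpDl // mulr_ge0 // exprn_ge0 ?ler0n.
rewrite mulrC ler_pdivrMr // -(ler_pM2r (_ : (0 < (g aD 0)%:R :> rat)%R));
  last by rewrite ltr0n (D_gt0 M_run).
rewrite mulrAC -!(objectiveE M_run).
have -> : (2 * k%:R ^+ 2 + 2 = (2 * k ^ 2 + 2)%N%:R :> rat)%R.
  by rewrite natrD natrM natrX.
by rewrite -natrM ler_nat mulnC out_approx.
Qed.

End Instance.

(** * Polynomial time *)

Lemma size_le_word_size w : size w <= word_size w.
Proof. by rewrite /word_size -sum1_size; apply: leq_sum. Qed.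

Lemma bitlen_nth w x : bitlen (nth 0 w x) <= (word_size w).+1.
Proof.
elim: w x => [|v w IH] x; first by rewrite nth_nil.
rewrite /word_size big_cons -/(word_size w); case: x => [|x] /=; first by lia.
by have := IH x; lia.
Qed.

Lemma word_size_drop k w : word_size (drop k w) <= word_size w.
Proof. by rewrite -{2}(cat_take_drop k w) /word_size big_cat /= leq_addl. Qed.

Section Sizes.
Variables (I : pip) (M : mem).
Hypothesis M_run : run_of (encode_pip I) tables M.
Local Notation g := (get M).
Local Notation L := (word_size (encode_pip I)).

Lemma pip_size_le : nrows I * ncols I + nrows I + ncols I <= L.
Proof.
apply: leq_trans (size_le_word_size _); rewrite encode_pipE /= size_cat.
by rewrite size_flatten_rat size_pip_rats; lia.
Qed.

Lemma get_K_le : g aK 0 <= L.+1.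
Proof.
have le_L := pip_size_le; rewrite (K_entry M_run) geq_max /=; apply/bigmax_leqP => j _.
apply: leq_trans (_ : nrows I <= _); last by lia.
rewrite -(get_m M_run) -[leqRHS]card_ord -sum1_card /support_size.
by apply: leq_sum => i _; case: (0 < _).
Qed.

(** Table sizes such as [2 * n * n] and [n * K] are at most quadratic in [L]; the third factor
    absorbs the constants. *)
Lemma cells_bounded : bounded_by L.+2 3 M (bN :: prog_bounds tables).
Proof.
have le_L := pip_size_le; have le_K := get_K_le.
have Z3 : L.+2 ^ 3 = L.+2 * (L.+2 * L.+2) by rewrite !expnS expn0 muln1.
have bm : g aHD 0 <= L.+2 ^ 3 by rewrite (get_m M_run) Z3; nia.
have bn : g aHD 1 <= L.+2 ^ 3 by rewrite (get_n M_run) Z3; nia.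
have bmn : g aMN 0 <= L.+2 ^ 3 by rewrite (get_mn M_run) Z3; nia.
have bnp : g aNP 0 <= L.+2 ^ 3 by rewrite (get_np M_run) Z3; nia.
have blen : g aLEN 0 <= L.+2 ^ 3.
  by rewrite (LEN_entry M_run) (get_np M_run) (get_n M_run) Z3; nia.
have le_n : ncols I <= L by lia.
have le_nn : ncols I * ncols I <= L * L by rewrite leq_mul.
have bnn : g aNN 0 <= L.+2 ^ 3 by rewrite (NN_entry M_run) (get_n M_run) Z3; nia.
have bn2 : g aN2 0 <= L.+2 ^ 3.
  by rewrite (N2_entry M_run) (NN_entry M_run) (get_n M_run) Z3; nia.
have bk : g aK 0 <= L.+2 ^ 3 by rewrite Z3; nia.
have bnk : g aNK 0 <= L.+2 ^ 3.
  have : ncols I * g aK 0 <= L * L.+1 by rewrite leq_mul.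
  by rewrite (NK_entry M_run) (get_n M_run) Z3; nia.
have b2 : 2 <= L.+2 ^ 3 by rewrite Z3; nia.
have b1 : 1 <= L.+2 ^ 3 by apply: ltnW.
rewrite /bounded_by [prog_bounds _]/= [all _ _]/=.
by rewrite ?bm ?bn ?bmn ?bnp ?blen ?bnn ?bn2 ?bk ?bnk ?b2 ?b1.
Qed.

End Sizes.

(** * Polynomial bit lengths of all tables *)

Definition poly_bits (a : nat) : Prop :=
  exists d, forall I M, run_of (encode_pip I) tables M ->
    forall i, bitlen (get M a i) <= (word_size (encode_pip I)).+2 ^ d.

Lemma poly_bits_uniform N : (forall a, a < N -> poly_bits a) ->
  exists d, forall I M, run_of (encode_pip I) tables M ->
    forall a i, a < N -> bitlen (get M a i) <= (word_size (encode_pip I)).+2 ^ d.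
Proof.
elim: N => [|N IH] bits; first by exists 0.
have [a lt_a|d1 le1] := IH; first by apply: bits; apply: ltnW.
have [d2 le2] := bits N (ltnSn N); exists (d1 + d2) => I M M_run a i.
rewrite ltnS leq_eqVlt => /predU1P[->|lt_a].
  by apply: leq_trans (le2 _ _ M_run i) (leq_Zexp _ (leq_addl _ _)).
by apply: leq_trans (le1 _ _ M_run a i lt_a) (leq_Zexp _ (leq_addr _ _)).
Qed.

Lemma stmt_bounded ss a Z d M : a < size ss ->
  bounded_by Z d M (prog_bounds ss) ->
  bounded_by Z d M (stmt_bounds (nth (In (BConst 0)) ss a)).
Proof.
elim: ss a => // st ss IH [|a] lt_a; rewrite /prog_bounds /= bounded_by_cat.
  by case/andP.
by case/andP=> _ /IH; apply.
Qed.

(** The greedy tables refer to themselves only inside subtrahends, which do not affect the size of a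
    value. Only [aR] needs a separate argument. *)
Definition well_founded_table (a : nat) : bool :=
  match nth (In (BConst 0)) tables a with
  | In b => bound_before a b
  | Tab b e => bound_before a b && ((a == aR) || all (ltn^~ a) (size_reads e))
  end.

Lemma well_founded_tables a : a < 26 -> well_founded_table a.
Proof.
have /allP wf : all well_founded_table (iota 0 26) by vm_compute.
by move=> lt_a; apply: wf; rewrite mem_iota.
Qed.

(* The residuals are the only table whose entries grow along the recursion: by
   the bits of [P * K] per step. *)
Lemma poly_bits_R : (forall a, a < aR -> poly_bits a) -> poly_bits aR.
Proof.
case/poly_bits_uniform => d le_d.
have [d' le_d'] : polyb (fun L => L.+2 ^ d + L.+2 ^ 3 * (2 * L.+2 ^ d)) by polyb_tac.
exists d' => I M M_run i; apply: leq_trans (le_d' _).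
set L := word_size _; have le := le_d I M M_run; rewrite -/L in le.
have [lt_i|le_i] := ltnP i (get M aN2 0); last first.
  have -> := tab_default (a := aR) M_run erefl isT isT le_i.
  by apply: leq_trans (leq_addr _ _); rewrite Zexp_gt0.
have N2_le : get M aN2 0 <= L.+2 ^ 3.
  have := @stmt_bounded tables aR _ _ _ isT (proj2 (andP (cells_bounded M_run))).
  by case/andP.
suff bits : bitlen (get M aR i) <= L.+2 ^ d + i * (2 * L.+2 ^ d).
  apply: leq_trans bits _; rewrite leq_add2l leq_mul2r; apply/orP; right.
  exact: leq_trans (ltnW lt_i) N2_le.
elim/ltn_ind: i lt_i => i IH lt_i; rewrite (R_entry M_run) //.
set n := get M aHD 1; have [q0|q_gt0] := posnP (i %/ n).
  rewrite q0 subn0 subnn mul0n addn0 mul1n; apply: leq_trans (leq_addr _ _).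
  apply: leq_trans (le aVAL (get M aMN 0 + get M aHD 0 + i) isT).
  by apply: bitlen_leq; case: (get M aU i); lia.
have n_gt0 : 0 < n by move: q_gt0; case: n.
have le_n : n <= i by rewrite -divn_gt0.
have -> : 1 - i %/ n = 0 by lia.
rewrite mul0n add0n subn0 mul1n.
have lt_in : i - n < i by lia.
apply: leq_trans (bitlen_leq (leq_subr _ _)) _; rewrite lt_in mul1n.
apply: leq_trans (bitlenM _ _) _.
have := bitlenM (get M aP 0) (get M aK 0).
have := le aP 0 isT; have := le aK 0 isT.
have := IH (i - n) lt_in (ltn_trans lt_in lt_i).
have : (i - n).+1 * (2 * L.+2 ^ d) <= i * (2 * L.+2 ^ d).
  by rewrite leq_mul2r lt_in orbT.
rewrite mulSn; lia.
Qed.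

Lemma word_size_input_at m w ss k : word_size (input_at m w ss k) <= word_size w.
Proof.
elim: ss m w k => [|st ss IH] m w [|k] //=; apply: leq_trans (IH _ _ _) _.
by case: st => //= b; apply: word_size_drop.
Qed.

(** Strong induction along the tables: inputs are bounded by the word size, and [eval_bits] carries
    the bounds of earlier tables over to the next one. *)
Lemma poly_bits_all a : a < 26 -> poly_bits a.
Proof.
elim/ltn_ind: a => a IH lt_a.
have [eq_R|neq_R] := eqVneq a aR.
  rewrite eq_R in IH *; apply: poly_bits_R => a' lt_a'.
  by apply: IH => //; apply: ltn_trans lt_a' _.
have := well_founded_tables lt_a; rewrite /well_founded_table (negPf neq_R).
have lt_size : a < size tables by [].
case eq_st : (nth _ _ _) => [b|b e] /=.
  move=> bb; exists 1 => I M M_run i; rewrite (in_entry M_run i eq_st lt_size bb).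
  rewrite expn1; case: ifP => // _; apply: leq_trans (bitlen_nth _ _) _.
  by rewrite ltnS; apply: leqW; apply: word_size_input_at.
case/andP=> bb /allP lt_reads.
have [a' lt_a'|D le_D] := @poly_bits_uniform a.
  by apply: IH => //; apply: ltn_trans lt_a' lt_a.
have [d le_d] := eval_bits (fun=> D) 3 e; exists d => I M M_run i.
have := stmt_bounded lt_size (proj2 (andP (cells_bounded M_run))).
rewrite eq_st => /andP[le_b bd].
have [lt_i|le_i] := ltnP i (bound_eval M b); last first.
  by rewrite (tab_default M_run eq_st lt_size bb le_i) Zexp_gt0.
have [m le_m ->] := tab_eval M_run eq_st lt_size bb lt_i.
apply: le_d => [a' i' a'_e||[|v]] /=.
- by apply: leq_trans (bitlen_leq (le_m _ _)) (le_D _ _ M_run _ _ (lt_reads _ a'_e)).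
- exact: mem_le_bounded le_m bd.
- exact: leq_trans (bitlen_ltn lt_i) le_b.
- by rewrite nth_nil Zexp_gt0.
Qed.

Lemma solver_correct : exists2 f, polyb f & forall I M,
  run_of (encode_pip I) tables M ->
  exists2 t, t <= f (word_size (encode_pip I)) &
    outputs_in solver (encode_pip I) t (encode_solution (out_vector I M)).
Proof.
have [D le_D] := poly_bits_uniform poly_bits_all.
have [f poly_f spec] := @compile_correct tables bN D 3 isT tables_wf isT.
exists f => // I M M_run; rewrite -(out_vectorE M_run).
have def_M := run_ofE M_run.
have := spec (word_size (encode_pip I)) (encode_pip I); rewrite -def_M; apply.
  move=> a i; have [lt_a|le_a] := ltnP a 26; first exact: le_D.
  rewrite get_default; first exact: Zexp_gt0.
  by apply: leq_trans le_a; rewrite def_M size_run.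
exact: cells_bounded.
Qed.

Local Open Scope ring_scope.

Theorem theorem2 :
  exists alg : program,
    polynomial_time alg pip_word /\
    forall (k : nat) (I : pip), column_sparse k I ->
      exists x : 'cV[nat]_(ncols I),
        outputs alg (encode_pip I) (encode_solution x) /\
        approx_solution (2 * k%:R ^+ 2 + 2) x.
Proof.
have [f [d le_d] spec] := solver_correct.
exists solver; split.
  exists (('X + 2%:P) ^+ d) => w [I ->].
  have [t le_t out_t] := spec I _ (RunOf _ _).
  exists t, (encode_solution (out_vector I (run [::] (encode_pip I) tables))).
  split=> //; apply: leq_trans le_t (leq_trans (le_d _) _).
  by rewrite horner_exp hornerD hornerX hornerC -addn2.
move=> k I sparse; have [t _ out_t] := spec I _ (RunOf _ _).
exists (out_vector I (run [::] (encode_pip I) tables)); split; first by exists t.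
exact: (out_vector_approx (RunOf _ _)).
Qed.
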